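(* In every Novikov algebra $A$ over $F$, the Jacobson radical $\mathcal J(A)$ coincides with the intersection of all primitive ideals of $A$. Every $\mathcal J$-semisimple Novikov algebra is a subdirect product of primitive (Novikov) algebras.
   Context: $F$ is a field of characteristic different from $2$; all algebras are (not necessarily associative or unital) algebras over $F$. Write $(x,y,z)=(xy)z-x(yz)$. An algebra is a Novikov algebra if it satisfies the identities $(x,y,z)=(y,x,z)$ and $(xy)z=(xz)y$. Right modules. Let $\mathcal N_X$ be the free Novikov algebra over $F$ on countably many generators $X=\{x_1,x_2,\dots\}$. For a vector space $V$ let $T(V)$ be its tensor algebra; a linear map $\varphi:V\to B$ to a unital associative algebra $B$ induces the homomorphism $T(\varphi):T(V)\to B$, $1\mapsto 1$, $v_1\otimes\dots\otimes v_n\mapsto\varphi(v_1)\cdots\varphi(v_n)$. Endomorphisms act on the right: $m(\alpha\beta)=(m\alpha)\beta$. Let $R:\mathcal N_X\to\mathrm{End}(\mathcal N_X)$, $R(f)=R_f$, $gR_f=gf$. Elements of the kernel of $T(R):T(\mathcal N_X)\to\mathrm{End}(\mathcal N_X)$ are called R-identities. For $G(x_1,\dots,x_n)\in T(\mathcal N_X)$ and $a_1,\dots,a_n$ in a Novikov algebra $A$, $G(a_1,\dots,a_n)\in T(A)$ is obtained by substituting $a_i$ for $x_i$. A right (Novikov) representation of $A$ is a linear map $\rho:A\to\mathrm{End}(M)$, $M$ a vector space, such that $T(\rho)(G(a_1,\dots,a_n))=0$ for every R-identity $G$ and all $a_i\in A$. The space $M$ with the action $m\cdot a=m\rho(a)$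 is then called a right (Novikov) $A$-module. A right $A$-module $M$ is irreducible if it has no nonzero proper submodules and $MA\neq 0$. Jacobson radical. $\mathcal J$ denotes the class of Novikov algebras over $F$ that have no irreducible right Novikov modules. This class is radical (in the Kurosh–Amitsur sense); in particular every Novikov algebra $A$ has a largest two-sided ideal $\mathcal J(A)$ which, as an algebra, belongs to $\mathcal J$. The ideal $\mathcal J(A)$ is called the Jacobson radical of $A$; $A$ is $\mathcal J$-semisimple if $\mathcal J(A)=0$. Primitivity. A right ideal $I\neq A$ of a Novikov algebra $A$ is modular if either there exist $e,f\in A$ such that $a-(a,e,f)\in I$ for every $a\in A$, or $I$ is a two-sided ideal such that $A/I$ is a commutative algebra with a unit. A maximal modular right ideal is a maximal right ideal (maximal among proper right ideals) that is modular. A Novikov algebra is primitive if it has a maximal modular right ideal that contains no nonzero two-sided ideals of $A$. A two-sided ideal $I$ of $A$ is primitive if the algebra $A/I$ is primitive. The intersection of the empty family of ideals of $A$ is understood to be $A$. *)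

(* Defs.v *)
From HB Require Import structures.
From mathcomp Require Import all_boot all_order all_algebra.
From mathcomp Require Import boolp classical_sets.

Set Implicit Arguments.
Unset Strict Implicit.
Unset Printing Implicit Defensive.

Import GRing.Theory.
Local Open Scope ring_scope.
Local Open Scope classical_set_scope.
Local Open Scope quotient_scope.

Reserved Notation "x *n y" (at level 40, left associativity).

HB.mixin Record Lmodule_isNaAlgebra (F : fieldType) A of GRing.Lmodule F A := {
  namul : A -> A -> A;
  namulDl : left_distributive namul +%R;
  namulDr : right_distributive namul +%R;
  namulZl : forall (c : F) (x y : A), namul (c *: x) y = c *: namul x y;
  namulZr : forall (c : F) (x y : A), namul x (c *: y) = c *: namul x y
}.

#[short(type="naAlgType")]
HB.structure Definition NaAlgebra (F : fieldType) :=
  {A of GRing.Lmodule F A & Lmodule_isNaAlgebra F A}.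

Notation "x *n y" := (namul x y) : ring_scope.

Definition associator (F : fieldType) (A : naAlgType F) (x y z : A) : A :=
  (x *n y) *n z - x *n (y *n z).

HB.mixin Record NaAlgebra_isNovikov (F : fieldType) A of NaAlgebra F A := {
  novikov_lsym : forall x y z : A, associator x y z = associator y x z;
  novikov_rcomm : forall x y z : A, (x *n y) *n z = (x *n z) *n y
}.

#[short(type="novikovType")]
HB.structure Definition Novikov (F : fieldType) :=
  {A of NaAlgebra F A & NaAlgebra_isNovikov F A}.

(* The library's [algType] requires [1 != 0], which fails for the             *)
(* endomorphism algebra of the zero space.                                    *)
HB.mixin Record NaAlgebra_isUnitalAssoc (F : fieldType) A of NaAlgebra F A := {
  uone : A;
  uamulA : associative (@namul F A);
  uamul1l : left_id uone (@namul F A);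
  uamul1r : right_id uone (@namul F A)
}.

#[short(type="uaAlgType")]
HB.structure Definition UnitalAssoc (F : fieldType) :=
  {A of NaAlgebra F A & NaAlgebra_isUnitalAssoc F A}.

Arguments uone {F}.

Definition endo (F : fieldType) (M : lmodType F) : Type := {linear M -> M}.

Section Endo.
Variables (F : fieldType) (M : lmodType F).
Implicit Types (f g h : endo M).

HB.instance Definition _ := gen_eqMixin (endo M).
HB.instance Definition _ := gen_choiceMixin (endo M).

Lemma endoP f g : (forall m, f m = g m) -> f = g.
Proof.
case: f => f [[f1] [f2]]; case: g => g [[g1] [g2]] /= fg.
have e : f = g by apply/funext.
subst g.
by rewrite (Prop_irrelevance f1 g1) (Prop_irrelevance f2 g2).
Qed.

Definition endo0 : endo M := (\0 : M -> M).
Definition endo_opp f : endo M := (\- f : M -> M).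
Definition endo_add f g : endo M := (f \+ g : M -> M).
Definition endo_scale (c : F) f : endo M := (c \*: f : M -> M).
Definition endo1 : endo M := (idfun : M -> M).
(* Endomorphisms act on the right: m (f g) = (m f) g.                         *)
Definition endo_mul f g : endo M := (g \o f : M -> M).

Fact endo_addA : associative endo_add.
Proof. by move=> f g h; apply: endoP => m /=; rewrite addrA. Qed.
Fact endo_addC : commutative endo_add.
Proof. by move=> f g; apply: endoP => m /=; rewrite addrC. Qed.
Fact endo_add0 : left_id endo0 endo_add.
Proof. by move=> f; apply: endoP => m /=; rewrite add0r. Qed.
Fact endo_addN : left_inverse endo0 endo_opp endo_add.
Proof. by move=> f; apply: endoP => m /=; rewrite addNr. Qed.

HB.instance Definition _ :=
  GRing.isZmodule.Build (endo M) endo_addA endo_addC endo_add0 endo_addN.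

Fact endo_scaleA (a b : F) f : endo_scale a (endo_scale b f) = endo_scale (a * b) f.
Proof. by apply: endoP => m /=; rewrite scalerA. Qed.
Fact endo_scale1 : left_id 1 endo_scale.
Proof. by move=> f; apply: endoP => m /=; rewrite scale1r. Qed.
Fact endo_scaleDr : right_distributive endo_scale +%R.
Proof. by move=> a f g; apply: endoP => m /=; rewrite scalerDr. Qed.
Fact endo_scaleDl f : {morph endo_scale^~ f : a b / a + b}.
Proof. by move=> a b; apply: endoP => m /=; rewrite scalerDl. Qed.

HB.instance Definition _ := GRing.Zmodule_isLmodule.Build F (endo M)
  endo_scaleA endo_scale1 endo_scaleDr endo_scaleDl.

Fact endo_mulDl : left_distributive endo_mul +%R.
Proof. by move=> f g h; apply: endoP => m /=; rewrite linearD. Qed.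
Fact endo_mulDr : right_distributive endo_mul +%R.
Proof. by move=> f g h; apply: endoP. Qed.
Fact endo_mulZl c f g : endo_mul (c *: f) g = c *: endo_mul f g.
Proof. by apply: endoP => m /=; rewrite linearZ. Qed.
Fact endo_mulZr c f g : endo_mul f (c *: g) = c *: endo_mul f g.
Proof. by apply: endoP. Qed.

HB.instance Definition _ := Lmodule_isNaAlgebra.Build F (endo M)
  endo_mulDl endo_mulDr endo_mulZl endo_mulZr.

Fact endo_mulA : associative endo_mul.
Proof. by move=> f g h; apply: endoP. Qed.
Fact endo_mul1l : left_id endo1 endo_mul.
Proof. by move=> f; apply: endoP. Qed.
Fact endo_mul1r : right_id endo1 endo_mul.
Proof. by move=> f; apply: endoP. Qed.

HB.instance Definition _ := NaAlgebra_isUnitalAssoc.Build F (endo M)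
  endo_mulA endo_mul1l endo_mul1r.

End Endo.

Section Presentation.
Variables (F : fieldType) (X : Type).

Inductive term : Type :=
  | Var of X
  | Zero
  | Add of term & term
  | Scale of F & term
  | Mul of term & term.

HB.instance Definition _ := gen_eqMixin term.
HB.instance Definition _ := gen_choiceMixin term.

Fixpoint eval (A : naAlgType F) (g : X -> A) (t : term) : A :=
  match t with
  | Var x => g x
  | Zero => 0
  | Add t u => eval g t + eval g u
  | Scale c t => c *: eval g t
  | Mul t u => eval g t *n eval g u
  end.

Definition term_sub (t u : term) : term := Add t (Scale (-1) u).
Definition term_assoc (t u v : term) : term :=
  term_sub (Mul (Mul t u) v) (Mul t (Mul u v)).

Variable E : term -> term -> Prop.

(* The least congruence on terms that contains [E] and whose quotient is an   *)
(* algebra over F.                                                            *)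
Inductive term_eq : term -> term -> Prop :=
  | te_rel t u : E t u -> term_eq t u
  | te_refl t : term_eq t t
  | te_sym t u : term_eq t u -> term_eq u t
  | te_trans t u v : term_eq t u -> term_eq u v -> term_eq t v
  | te_add t t' u u' : term_eq t t' -> term_eq u u' -> term_eq (Add t u) (Add t' u')
  | te_scale c t t' : term_eq t t' -> term_eq (Scale c t) (Scale c t')
  | te_mul t t' u u' : term_eq t t' -> term_eq u u' -> term_eq (Mul t u) (Mul t' u')
  | te_addA t u v : term_eq (Add t (Add u v)) (Add (Add t u) v)
  | te_addC t u : term_eq (Add t u) (Add u t)
  | te_add0 t : term_eq (Add Zero t) t
  | te_scale0 t : term_eq (Scale 0 t) Zero
  | te_scale1 t : term_eq (Scale 1 t) t
  | te_scaleA a b t : term_eq (Scale a (Scale b t)) (Scale (a * b) t)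
  | te_scaleDr a t u : term_eq (Scale a (Add t u)) (Add (Scale a t) (Scale a u))
  | te_scaleDl a b t : term_eq (Scale (a + b) t) (Add (Scale a t) (Scale b t))
  | te_mulDl t u v : term_eq (Mul (Add t u) v) (Add (Mul t v) (Mul u v))
  | te_mulDr t u v : term_eq (Mul t (Add u v)) (Add (Mul t u) (Mul t v))
  | te_mulZl c t u : term_eq (Mul (Scale c t) u) (Scale c (Mul t u))
  | te_mulZr c t u : term_eq (Mul t (Scale c u)) (Scale c (Mul t u)).

Lemma eval_term_eq (A : naAlgType F) (g : X -> A) :
  (forall t u, E t u -> eval g t = eval g u) ->
  forall t u, term_eq t u -> eval g t = eval g u.
Proof.
move=> gE t u; elim=> {t u} /=.
- exact: gE.
- by [].
- by [].
- by move=> t u v _ -> _ ->.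
- by move=> t t' u u' _ -> _ ->.
- by move=> c t t' _ ->.
- by move=> t t' u u' _ -> _ ->.
- by move=> *; rewrite addrA.
- by move=> *; rewrite addrC.
- by move=> *; rewrite add0r.
- by move=> *; rewrite scale0r.
- by move=> *; rewrite scale1r.
- by move=> *; rewrite scalerA.
- by move=> *; rewrite scalerDr.
- by move=> *; rewrite scalerDl.
- by move=> *; rewrite namulDl.
- by move=> *; rewrite namulDr.
- by move=> *; rewrite namulZl.
- by move=> *; rewrite namulZr.
Qed.

Definition term_eqb (t u : term) : bool := `[< term_eq t u >].

Fact term_eqb_refl : reflexive term_eqb.
Proof. by move=> t; apply/asboolP/te_refl. Qed.
Fact term_eqb_sym : symmetric term_eqb.
Proof. by move=> t u; apply/asboolP/asboolP => /te_sym. Qed.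
Fact term_eqb_trans : transitive term_eqb.
Proof.
by move=> u t v /asboolP tu /asboolP uv; apply/asboolP; apply: te_trans tu uv.
Qed.

Canonical term_equiv :=
  EquivRel term_eqb term_eqb_refl term_eqb_sym term_eqb_trans.

Definition presented : Type := {eq_quot term_equiv}.

HB.instance Definition _ := Choice.on presented.
HB.instance Definition _ := EqQuotient.on presented.

Definition pclass (t : term) : presented := \pi_presented t.

Lemma pclassP t u : pclass t = pclass u <-> term_eq t u.
Proof.
split; first by move/eqmodP/asboolP.
by move=> tu; apply/eqmodP/asboolP.
Qed.

Lemma pclassK (x : presented) : pclass (repr x) = x.
Proof. exact: reprK. Qed.

Lemma repr_pclass t : term_eq (repr (pclass t)) t.
Proof. by apply/pclassP; rewrite pclassK. Qed.

Definition padd (x y : presented) := pclass (Add (repr x) (repr y)).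
Definition pscale (c : F) (x : presented) := pclass (Scale c (repr x)).
Definition pmul (x y : presented) := pclass (Mul (repr x) (repr y)).
Definition pzero := pclass Zero.
Definition popp (x : presented) := pscale (-1) x.

Lemma paddE t u : padd (pclass t) (pclass u) = pclass (Add t u).
Proof. by apply/pclassP; apply: te_add; apply: repr_pclass. Qed.
Lemma pscaleE c t : pscale c (pclass t) = pclass (Scale c t).
Proof. by apply/pclassP; apply: te_scale; apply: repr_pclass. Qed.
Lemma pmulE t u : pmul (pclass t) (pclass u) = pclass (Mul t u).
Proof. by apply/pclassP; apply: te_mul; apply: repr_pclass. Qed.

Lemma pclass_ind (P : presented -> Prop) : (forall t, P (pclass t)) -> forall x, P x.
Proof. by move=> Pt x; rewrite -(pclassK x). Qed.

Fact paddA : associative padd.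
Proof.
elim/pclass_ind=> t; elim/pclass_ind=> u; elim/pclass_ind=> v.
by rewrite !paddE; apply/pclassP/te_addA.
Qed.
Fact paddC : commutative padd.
Proof.
elim/pclass_ind=> t; elim/pclass_ind=> u.
by rewrite !paddE; apply/pclassP/te_addC.
Qed.
Fact padd0 : left_id pzero padd.
Proof. by elim/pclass_ind=> t; rewrite !paddE; apply/pclassP/te_add0. Qed.
Fact paddN : left_inverse pzero popp padd.
Proof.
elim/pclass_ind=> t; rewrite /popp !pscaleE !paddE; apply/pclassP.
apply: te_trans (te_scale0 t); rewrite -(addNr 1).
apply: te_sym; apply: te_trans (te_scaleDl _ _ _) _.
by apply: te_add; [apply: te_refl | apply: te_scale1].
Qed.

HB.instance Definition _ := GRing.isZmodule.Build presented paddA paddC padd0 paddN.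

Fact pscaleA a b (x : presented) : pscale a (pscale b x) = pscale (a * b) x.
Proof.
by elim/pclass_ind: x => t; rewrite !pscaleE; apply/pclassP/te_scaleA.
Qed.
Fact pscale1 : left_id 1 pscale.
Proof. by elim/pclass_ind=> t; rewrite !pscaleE; apply/pclassP/te_scale1. Qed.
Fact pscaleDr : right_distributive pscale +%R.
Proof.
move=> c; elim/pclass_ind=> t; elim/pclass_ind=> u.
rewrite [X in pscale c X]paddE [RHS]/GRing.add /= !pscaleE paddE.
exact/pclassP/te_scaleDr.
Qed.
Fact pscaleDl x : {morph pscale^~ x : a b / a + b}.
Proof.
elim/pclass_ind: x => t a b.
by rewrite [RHS]/GRing.add /= !pscaleE paddE; apply/pclassP/te_scaleDl.
Qed.

HB.instance Definition _ := GRing.Zmodule_isLmodule.Build F presented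
  pscaleA pscale1 pscaleDr pscaleDl.

Lemma pclassD t u : pclass (Add t u) = pclass t + pclass u.
Proof. by rewrite -paddE. Qed.
Lemma pclassZ c t : pclass (Scale c t) = c *: pclass t.
Proof. by rewrite -pscaleE. Qed.

Fact pmulDl : left_distributive pmul +%R.
Proof.
elim/pclass_ind=> t; elim/pclass_ind=> u; elim/pclass_ind=> v.
by rewrite -pclassD !pmulE -pclassD; apply/pclassP/te_mulDl.
Qed.
Fact pmulDr : right_distributive pmul +%R.
Proof.
elim/pclass_ind=> t; elim/pclass_ind=> u; elim/pclass_ind=> v.
by rewrite -pclassD !pmulE -pclassD; apply/pclassP/te_mulDr.
Qed.
Fact pmulZl c x y : pmul (c *: x) y = c *: pmul x y.
Proof.
elim/pclass_ind: x => t; elim/pclass_ind: y => u.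
by rewrite -pclassZ !pmulE -pclassZ; apply/pclassP/te_mulZl.
Qed.
Fact pmulZr c x y : pmul x (c *: y) = c *: pmul x y.
Proof.
elim/pclass_ind: x => t; elim/pclass_ind: y => u.
by rewrite -pclassZ !pmulE -pclassZ; apply/pclassP/te_mulZr.
Qed.

HB.instance Definition _ := Lmodule_isNaAlgebra.Build F presented
  pmulDl pmulDr pmulZl pmulZr.

Lemma pclassM t u : pclass (Mul t u) = pclass t *n pclass u.
Proof. by rewrite -pmulE. Qed.

Definition peval (A : naAlgType F) (g : X -> A) (x : presented) : A :=
  eval g (repr x).

Section Peval.
Variables (A : naAlgType F) (g : X -> A).
Hypothesis gE : forall t u, E t u -> eval g t = eval g u.

Lemma peval_pclass t : peval g (pclass t) = eval g t.
Proof. exact: eval_term_eq gE _ _ (repr_pclass t). Qed.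

Lemma peval_linear : linear (peval g).
Proof.
move=> c; elim/pclass_ind=> t; elim/pclass_ind=> u.
by rewrite -pclassZ -pclassD !peval_pclass.
Qed.

Lemma pevalM x y : peval g (x *n y) = peval g x *n peval g y.
Proof.
elim/pclass_ind: x => t; elim/pclass_ind: y => u.
by rewrite -pclassM !peval_pclass.
Qed.

End Peval.

End Presentation.

Section FreeNovikov.
Variable F : fieldType.

Inductive novikov_rel : term F nat -> term F nat -> Prop :=
  | nr_lsym t u v : novikov_rel (term_assoc t u v) (term_assoc u t v)
  | nr_rcomm t u v : novikov_rel (Mul (Mul t u) v) (Mul (Mul t v) u).

Definition free_novikov : Type := presented novikov_rel.

HB.instance Definition _ := NaAlgebra.on free_novikov.

Let pclass_assoc t u v : pclass novikov_rel (term_assoc t u v) =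
  associator (pclass novikov_rel t) (pclass novikov_rel u) (pclass novikov_rel v).
Proof. by rewrite pclassD pclassZ scaleN1r !pclassM. Qed.

Fact free_novikov_lsym (x y z : free_novikov) : associator x y z = associator y x z.
Proof.
elim/pclass_ind: x => t; elim/pclass_ind: y => u; elim/pclass_ind: z => v.
by have /te_rel/pclassP := nr_lsym t u v; rewrite !pclass_assoc.
Qed.
Fact free_novikov_rcomm (x y z : free_novikov) : (x *n y) *n z = (x *n z) *n y.
Proof.
elim/pclass_ind: x => t; elim/pclass_ind: y => u; elim/pclass_ind: z => v.
by have /te_rel/pclassP := nr_rcomm t u v; rewrite !pclassM.
Qed.

HB.instance Definition _ := NaAlgebra_isNovikov.Build F free_novikov
  free_novikov_lsym free_novikov_rcomm.

Definition free_gen (i : nat) : free_novikov := pclass novikov_rel (Var F i).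

Section Hom.
Variables (A : novikovType F) (a : nat -> A).

Definition free_novikov_hom : free_novikov -> A := peval a.

Fact free_novikov_hom_wf t u : novikov_rel t u -> eval a t = eval a u.
Proof.
by case=> {t u} t u v /=; rewrite ?scaleN1r; [apply: novikov_lsym|apply: novikov_rcomm].
Qed.

HB.instance Definition _ := GRing.isLinear.Build F free_novikov A _
  free_novikov_hom (peval_linear free_novikov_hom_wf).

Lemma free_novikov_hom_gen i : free_novikov_hom (free_gen i) = a i.
Proof. exact: (peval_pclass free_novikov_hom_wf). Qed.

Lemma free_novikov_homM (x y : free_novikov) :
  free_novikov_hom (x *n y) = free_novikov_hom x *n free_novikov_hom y.
Proof. exact: (pevalM free_novikov_hom_wf). Qed.

End Hom.
End FreeNovikov.

(* T(V) is the unital associative algebra presented by generators [v : V]     *)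
(* ([Some v], with [None] standing for 1) subject to linearity in v.          *)
Section TensorAlgebra.
Variables (F : fieldType) (V : lmodType F).

Notation one := (Var F (None : option V)).
Notation gen v := (Var F (Some (v : V))).

Inductive tensor_rel : term F (option V) -> term F (option V) -> Prop :=
  | tr_mulA t u v : tensor_rel (Mul t (Mul u v)) (Mul (Mul t u) v)
  | tr_mul1l t : tensor_rel (Mul one t) t
  | tr_mul1r t : tensor_rel (Mul t one) t
  | tr_genD u v : tensor_rel (gen (u + v)) (Add (gen u) (gen v))
  | tr_genZ c v : tensor_rel (gen (c *: v)) (Scale c (gen v)).

Definition tensor : Type := presented tensor_rel.

HB.instance Definition _ := NaAlgebra.on tensor.

Definition tensor1 : tensor := pclass tensor_rel one.

Fact tensor_mulA : associative (@namul F tensor).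
Proof.
elim/pclass_ind=> t; elim/pclass_ind=> u; elim/pclass_ind=> v.
by have /te_rel/pclassP := tr_mulA t u v; rewrite !pclassM.
Qed.
Fact tensor_mul1l : left_id tensor1 (@namul F tensor).
Proof. by elim/pclass_ind=> t; have /te_rel/pclassP := tr_mul1l t; rewrite !pclassM. Qed.
Fact tensor_mul1r : right_id tensor1 (@namul F tensor).
Proof. by elim/pclass_ind=> t; have /te_rel/pclassP := tr_mul1r t; rewrite !pclassM. Qed.

HB.instance Definition _ := NaAlgebra_isUnitalAssoc.Build F tensor
  tensor_mulA tensor_mul1l tensor_mul1r.

Definition tensor_gen (v : V) : tensor := pclass tensor_rel (gen v).

Fact tensor_gen_linear : linear tensor_gen.
Proof.
move=> c u v; rewrite /tensor_gen -pclassZ -pclassD; apply/pclassP.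
apply: te_trans (te_rel (tr_genD _ _)) _.
by apply: te_add; [apply: te_rel; apply: tr_genZ | apply: te_refl].
Qed.

HB.instance Definition _ :=
  GRing.isLinear.Build F V tensor _ tensor_gen tensor_gen_linear.

Section Hom.
Variables (B : uaAlgType F) (phi : {linear V -> B}).

Definition tensor_val (x : option V) : B := if x is Some v then phi v else uone B.

Definition tensor_hom : tensor -> B := peval tensor_val.

Fact tensor_hom_wf t u : tensor_rel t u -> eval tensor_val t = eval tensor_val u.
Proof.
case=> {t u} /=.
- by move=> *; rewrite uamulA.
- by move=> *; rewrite uamul1l.
- by move=> *; rewrite uamul1r.
- by move=> *; rewrite linearD.
- by move=> *; rewrite linearZ.
Qed.

HB.instance Definition _ :=
  GRing.isLinear.Build F tensor B _ tensor_hom (peval_linear tensor_hom_wf).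

Lemma tensor_hom_gen v : tensor_hom (tensor_gen v) = phi v.
Proof. exact: (peval_pclass tensor_hom_wf). Qed.

Lemma tensor_hom1 : tensor_hom (uone tensor) = uone B.
Proof. exact: (peval_pclass tensor_hom_wf). Qed.

Lemma tensor_homM (x y : tensor) :
  tensor_hom (x *n y) = tensor_hom x *n tensor_hom y.
Proof. exact: (pevalM tensor_hom_wf). Qed.

End Hom.
End TensorAlgebra.

Section RightModules.
Variable F : fieldType.

Section RightMult.
Variable A : naAlgType F.

Definition rmul_fun (f g : A) : A := g *n f.

Fact rmul_fun_linear f : linear (rmul_fun f).
Proof. by move=> c x y; rewrite /rmul_fun namulDl namulZl. Qed.

HB.instance Definition _ f :=
  GRing.isLinear.Build F A A _ (rmul_fun f) (rmul_fun_linear f).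

Definition rmul (f : A) : endo A := (rmul_fun f : A -> A).

Fact rmul_linear : linear rmul.
Proof. by move=> c f g; apply: endoP => x /=; rewrite /rmul_fun namulDr namulZr. Qed.

HB.instance Definition _ := GRing.isLinear.Build F A (endo A) _ rmul rmul_linear.

End RightMult.

Definition R_identity (G : tensor (free_novikov F)) : Prop :=
  tensor_hom (@rmul (free_novikov F)) G = 0.

(* G(a_0, a_1, ...) in T(A).  Only finitely many generators occur in G.       *)
Definition tensor_subst (A : novikovType F) (a : nat -> A)
    (G : tensor (free_novikov F)) : tensor A :=
  tensor_hom (@tensor_gen F A \o free_novikov_hom a) G.

Definition right_representation (A : novikovType F) (M : lmodType F)
    (rho : {linear A -> endo M}) : Prop :=
  forall (G : tensor (free_novikov F)) (a : nat -> A),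
    R_identity G -> tensor_hom rho (tensor_subst a G) = 0.

Definition is_subspace (V : lmodType F) (S : set V) : Prop :=
  S 0 /\ forall (c : F) (x y : V), S x -> S y -> S (c *: x + y).

Definition is_submodule (A : novikovType F) (M : lmodType F)
    (rho : {linear A -> endo M}) (N : set M) : Prop :=
  is_subspace N /\ forall (m : M) (a : A), N m -> N (rho a m).

Definition irreducible_module (A : novikovType F) (M : lmodType F)
    (rho : {linear A -> endo M}) : Prop :=
  (forall N : set M, is_submodule rho N -> N = [set 0] \/ N = setT) /\
  (exists (m : M) (a : A), rho a m <> 0).

Definition radical_class (A : novikovType F) : Prop :=
  forall (M : lmodType F) (rho : {linear A -> endo M}),
    right_representation rho -> ~ irreducible_module rho.

End RightModules.

Section Ideals.
Variables (F : fieldType) (A : naAlgType F).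

Definition is_right_ideal (I : set A) : Prop :=
  is_subspace I /\ forall x y : A, I x -> I (x *n y).

Definition is_left_ideal (I : set A) : Prop :=
  is_subspace I /\ forall x y : A, I x -> I (y *n x).

Definition is_ideal (I : set A) : Prop := is_left_ideal I /\ is_right_ideal I.

Record ideal : Type := Ideal {
  ideal_set :> set A;
  idealP : is_ideal ideal_set
}.

Variable I : ideal.

Lemma ideal0 : ideal_set I 0. Proof. by case: (idealP I) => -[[]]. Qed.
Lemma idealS c x y : ideal_set I x -> ideal_set I y -> ideal_set I (c *: x + y).
Proof. by case: (idealP I) => -[[_ h] _] _; apply: h. Qed.
Lemma idealD x y : ideal_set I x -> ideal_set I y -> ideal_set I (x + y).
Proof. by move=> Ix Iy; rewrite -[x]scale1r; apply: idealS. Qed.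
Lemma idealZ c x : ideal_set I x -> ideal_set I (c *: x).
Proof. by move=> Ix; rewrite -[_ *: _]addr0; apply: idealS => //; apply: ideal0. Qed.
Lemma idealN x : ideal_set I x -> ideal_set I (- x).
Proof. by rewrite -scaleN1r; apply: idealZ. Qed.
Lemma idealMl x y : ideal_set I x -> ideal_set I (y *n x).
Proof. by case: (idealP I) => -[_ h] _; apply: h. Qed.
Lemma idealMr x y : ideal_set I x -> ideal_set I (x *n y).
Proof. by case: (idealP I) => _ [_ h]; apply: h. Qed.

End Ideals.

Lemma namulNl (F : fieldType) (A : naAlgType F) (x y : A) : (- x) *n y = - (x *n y).
Proof. by rewrite -scaleN1r namulZl scaleN1r. Qed.
Lemma namulNr (F : fieldType) (A : naAlgType F) (x y : A) : x *n (- y) = - (x *n y).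
Proof. by rewrite -scaleN1r namulZr scaleN1r. Qed.

(* An ideal as an algebra.                                                    *)
Section IdealAlgebra.
Variables (F : fieldType) (A : naAlgType F) (I : ideal A).

Definition ideal_pred : pred A := fun x => `[< ideal_set I x >].

Fact ideal_pred_submod : submod_closed ideal_pred.
Proof.
split; first by apply/asboolP/ideal0.
by move=> c x y /asboolP Ix /asboolP Iy; apply/asboolP/idealS.
Qed.

HB.instance Definition _ :=
  GRing.isSubmodClosed.Build F A ideal_pred ideal_pred_submod.

Definition ideal_alg : Type := {x : A | ideal_pred x}.

HB.instance Definition _ := SubChoice.on ideal_alg.
HB.instance Definition _ := [SubChoice_isSubLmodule of ideal_alg by <:].

Fact ideal_alg_mul_subproof (x y : ideal_alg) : ideal_pred (\val x *n \val y).
Proof. by apply/asboolP/idealMr/asboolP/(valP x). Qed.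

Definition ideal_alg_mul (x y : ideal_alg) : ideal_alg :=
  Sub (\val x *n \val y) (ideal_alg_mul_subproof x y).

Fact ideal_alg_mulDl : left_distributive ideal_alg_mul +%R.
Proof. by move=> x y z; apply: val_inj; rewrite /= namulDl. Qed.
Fact ideal_alg_mulDr : right_distributive ideal_alg_mul +%R.
Proof. by move=> x y z; apply: val_inj; rewrite /= namulDr. Qed.
Fact ideal_alg_mulZl c x y : ideal_alg_mul (c *: x) y = c *: ideal_alg_mul x y.
Proof. by apply: val_inj; rewrite /= namulZl. Qed.
Fact ideal_alg_mulZr c x y : ideal_alg_mul x (c *: y) = c *: ideal_alg_mul x y.
Proof. by apply: val_inj; rewrite /= namulZr. Qed.

HB.instance Definition _ := Lmodule_isNaAlgebra.Build F ideal_alg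
  ideal_alg_mulDl ideal_alg_mulDr ideal_alg_mulZl ideal_alg_mulZr.

End IdealAlgebra.

Section IdealNovikov.
Variables (F : fieldType) (A : novikovType F) (I : ideal A).

Fact ideal_alg_lsym (x y z : ideal_alg I) : associator x y z = associator y x z.
Proof. exact/val_inj/(novikov_lsym (\val x) (\val y) (\val z)). Qed.
Fact ideal_alg_rcomm (x y z : ideal_alg I) : (x *n y) *n z = (x *n z) *n y.
Proof. exact/val_inj/(novikov_rcomm (\val x) (\val y) (\val z)). Qed.

HB.instance Definition _ := NaAlgebra_isNovikov.Build F (ideal_alg I)
  ideal_alg_lsym ideal_alg_rcomm.

End IdealNovikov.

(* The quotient algebra A/I.                                                  *)
Section QuotientAlgebra.
Variables (F : fieldType) (A : naAlgType F) (I : ideal A).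

Definition ideal_eqb (x y : A) : bool := `[< ideal_set I (x - y) >].

Fact ideal_eqb_refl : reflexive ideal_eqb.
Proof. by move=> x; apply/asboolP; rewrite subrr; apply: ideal0. Qed.
Fact ideal_eqb_sym : symmetric ideal_eqb.
Proof. by move=> x y; apply/asboolP/asboolP => /idealN; rewrite opprB. Qed.
Fact ideal_eqb_trans : transitive ideal_eqb.
Proof.
move=> y x z /asboolP xy /asboolP yz; apply/asboolP.
by rewrite -(subrKA y); apply: idealD.
Qed.

Canonical ideal_equiv :=
  EquivRel ideal_eqb ideal_eqb_refl ideal_eqb_sym ideal_eqb_trans.

Definition quot_alg : Type := {eq_quot ideal_equiv}.

HB.instance Definition _ := Choice.on quot_alg.
HB.instance Definition _ := EqQuotient.on quot_alg.

Definition qclass (x : A) : quot_alg := \pi_quot_alg x.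

Lemma qclassP x y : qclass x = qclass y <-> ideal_set I (x - y).
Proof.
split; first by move/eqmodP/asboolP.
by move=> xy; apply/eqmodP/asboolP.
Qed.

Lemma qclassK (x : quot_alg) : qclass (repr x) = x.
Proof. exact: reprK. Qed.

Lemma repr_qclass x : ideal_set I (repr (qclass x) - x).
Proof. by apply/qclassP; rewrite qclassK. Qed.

Lemma qclass_ind (P : quot_alg -> Prop) : (forall x, P (qclass x)) -> forall x, P x.
Proof. by move=> Px x; rewrite -(qclassK x). Qed.

Definition qadd (x y : quot_alg) := qclass (repr x + repr y).
Definition qopp (x : quot_alg) := qclass (- repr x).
Definition qscale (c : F) (x : quot_alg) := qclass (c *: repr x).
Definition qmul (x y : quot_alg) := qclass (repr x *n repr y).

Lemma qaddE x y : qadd (qclass x) (qclass y) = qclass (x + y).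
Proof. by apply/qclassP; rewrite opprD addrACA; apply: idealD; apply: repr_qclass. Qed.
Lemma qoppE x : qopp (qclass x) = qclass (- x).
Proof. by apply/qclassP; rewrite -opprD; apply: idealN; apply: repr_qclass. Qed.
Lemma qscaleE c x : qscale c (qclass x) = qclass (c *: x).
Proof. by apply/qclassP; rewrite -scalerBr; apply: idealZ; apply: repr_qclass. Qed.
Lemma qmulE x y : qmul (qclass x) (qclass y) = qclass (x *n y).
Proof.
apply/qclassP; rewrite -(subrKA (x *n repr (qclass y))).
apply: idealD.
  by rewrite -namulNl -namulDl; apply/idealMr/repr_qclass.
by rewrite -namulNr -namulDr; apply/idealMl/repr_qclass.
Qed.

Fact qaddA : associative qadd.
Proof.
elim/qclass_ind=> x; elim/qclass_ind=> y; elim/qclass_ind=> z.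
by rewrite !qaddE addrA.
Qed.
Fact qaddC : commutative qadd.
Proof. by elim/qclass_ind=> x; elim/qclass_ind=> y; rewrite !qaddE addrC. Qed.
Fact qadd0 : left_id (qclass 0) qadd.
Proof. by elim/qclass_ind=> x; rewrite !qaddE add0r. Qed.
Fact qaddN : left_inverse (qclass 0) qopp qadd.
Proof. by elim/qclass_ind=> x; rewrite qoppE qaddE addNr. Qed.

HB.instance Definition _ := GRing.isZmodule.Build quot_alg qaddA qaddC qadd0 qaddN.

Lemma qclassD x y : qclass (x + y) = qclass x + qclass y.
Proof. by rewrite -qaddE. Qed.

Fact qscaleA a b (x : quot_alg) : qscale a (qscale b x) = qscale (a * b) x.
Proof. by elim/qclass_ind: x => x; rewrite !qscaleE scalerA. Qed.
Fact qscale1 : left_id 1 qscale.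
Proof. by elim/qclass_ind=> x; rewrite !qscaleE scale1r. Qed.
Fact qscaleDr : right_distributive qscale +%R.
Proof.
move=> c; elim/qclass_ind=> x; elim/qclass_ind=> y.
by rewrite -qclassD !qscaleE scalerDr qclassD.
Qed.
Fact qscaleDl x : {morph qscale^~ x : a b / a + b}.
Proof.
by elim/qclass_ind: x => x a b; rewrite !qscaleE scalerDl qclassD.
Qed.

HB.instance Definition _ := GRing.Zmodule_isLmodule.Build F quot_alg
  qscaleA qscale1 qscaleDr qscaleDl.

Lemma qclassZ c x : qclass (c *: x) = c *: qclass x.
Proof. by rewrite -qscaleE. Qed.

Fact qmulDl : left_distributive qmul +%R.
Proof.
elim/qclass_ind=> x; elim/qclass_ind=> y; elim/qclass_ind=> z.
by rewrite -qclassD !qmulE namulDl qclassD.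
Qed.
Fact qmulDr : right_distributive qmul +%R.
Proof.
elim/qclass_ind=> x; elim/qclass_ind=> y; elim/qclass_ind=> z.
by rewrite -qclassD !qmulE namulDr qclassD.
Qed.
Fact qmulZl c x y : qmul (c *: x) y = c *: qmul x y.
Proof.
elim/qclass_ind: x => x; elim/qclass_ind: y => y.
by rewrite -qclassZ !qmulE namulZl qclassZ.
Qed.
Fact qmulZr c x y : qmul x (c *: y) = c *: qmul x y.
Proof.
elim/qclass_ind: x => x; elim/qclass_ind: y => y.
by rewrite -qclassZ !qmulE namulZr qclassZ.
Qed.

HB.instance Definition _ := Lmodule_isNaAlgebra.Build F quot_alg
  qmulDl qmulDr qmulZl qmulZr.

Lemma qclassM x y : qclass (x *n y) = qclass x *n qclass y.
Proof. by rewrite -qmulE. Qed.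

Fact qclass_linear : linear qclass.
Proof. by move=> c x y; rewrite qclassD qclassZ. Qed.

HB.instance Definition _ := GRing.isLinear.Build F A quot_alg _ qclass qclass_linear.

Lemma qclass_associator x y z :
  qclass (associator x y z) = associator (qclass x) (qclass y) (qclass z).
Proof. by rewrite /associator linearB /= !qclassM. Qed.

End QuotientAlgebra.

Section QuotientNovikov.
Variables (F : fieldType) (A : novikovType F) (I : ideal A).

Fact quot_alg_lsym (x y z : quot_alg I) : associator x y z = associator y x z.
Proof.
elim/qclass_ind: x => x; elim/qclass_ind: y => y; elim/qclass_ind: z => z.
by rewrite -!qclass_associator novikov_lsym.
Qed.
Fact quot_alg_rcomm (x y z : quot_alg I) : (x *n y) *n z = (x *n z) *n y.
Proof.
elim/qclass_ind: x => x; elim/qclass_ind: y => y; elim/qclass_ind: z => z.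
by rewrite -!qclassM novikov_rcomm.
Qed.

HB.instance Definition _ := NaAlgebra_isNovikov.Build F (quot_alg I)
  quot_alg_lsym quot_alg_rcomm.

End QuotientNovikov.

Section Primitivity.
Variable F : fieldType.

Definition commutative_unital (A : naAlgType F) : Prop :=
  (forall x y : A, x *n y = y *n x) /\
  (exists u : A, forall x : A, u *n x = x /\ x *n u = x).

Definition is_modular (A : naAlgType F) (I : set A) : Prop :=
  [/\ is_right_ideal I, I <> setT &
    (exists e f : A, forall a : A, I (a - associator a e f)) \/
    (exists2 J : ideal A, I = J & commutative_unital (quot_alg J))].

Definition is_maximal_right_ideal (A : naAlgType F) (I : set A) : Prop :=
  [/\ is_right_ideal I, I <> setT &
    forall J : set A, is_right_ideal J -> J <> setT -> I `<=` J -> J = I].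

Definition primitive_algebra (A : novikovType F) : Prop :=
  exists I : set A, [/\ is_maximal_right_ideal I, is_modular I &
    forall J : set A, is_ideal J -> J `<=` I -> J = [set 0]].

Definition primitive_ideal (A : novikovType F) (I : ideal A) : Prop :=
  primitive_algebra (quot_alg I).

(* This is A when A has no primitive ideals.                                  *)
Definition primitive_intersection (A : novikovType F) : set A :=
  [set x | forall I : ideal A, primitive_ideal I -> ideal_set I x].

(* [J] is J(A), the largest ideal of A that belongs to the radical class.     *)
Definition is_jacobson_radical (A : novikovType F) (J : set A) : Prop :=
  exists I : ideal A, [/\ J = I, radical_class (ideal_alg I) &
    forall I' : ideal A, radical_class (ideal_alg I') -> I' `<=` I].

Definition J_semisimple (A : novikovType F) : Prop :=
  is_jacobson_radical [set (0 : A)].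

Definition is_alg_hom (A B : naAlgType F) (f : A -> B) : Prop :=
  linear f /\ forall x y : A, f (x *n y) = f x *n f y.

(* [f] embeds A into the direct product of the [B k], and every projection    *)
(* of its image is onto.                                                      *)
Definition is_subdirect_product (A : naAlgType F) (K : Type)
    (B : K -> novikovType F) : Prop :=
  exists f : A -> forall k, B k,
    [/\ injective f,
        forall k, is_alg_hom (fun x => f x k) &
        forall k (b : B k), exists x : A, f x k = b].

End Primitivity.

Arguments primitive_intersection {F} A.
Arguments is_jacobson_radical {F} A J.
Arguments radical_class {F} A.
Arguments J_semisimple {F} A.
Arguments primitive_algebra {F} A.
Arguments is_subdirect_product {F} A {K} B.

(* Main.v *)
Require Import Defs.
From mathcomp Require Import all_boot all_order all_algebra.
From mathcomp Require Import boolp classical_sets.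
From HB Require Import structures.
Local Open Scope ring_scope.

(* Every Novikov algebra satisfies [(x a, y, z) = (x, y a, z) = (x, y, z) a].  *)
(* Hence in a right module [b(x, y) := rho (x y) - rho x rho y] satisfies      *)
(* [b(x y, z) = b(x, z) rho y], and the [rho x] commute.  If the module is     *)
(* irreducible, Schur's lemma makes the kernel of [rho] (when [b = 0]) or of   *)
(* [x |-> m b(x, y0)] (when [b] is not [0]) a maximal modular right ideal.     *)
(* For an ideal [P] of [A], a maximal modular right ideal [I] of [P] pulls     *)
(* back along [a |-> (a, e, f)] (or [a |-> a e] when [P / I] is a field) to    *)
(* one of [A] not containing [P]; so the intersection of the primitive ideals  *)
(* has no irreducible module.  Conversely, if an ideal [J] is not contained in *)
(* a maximal modular right ideal [I] of [A], then [J / (I :&: J)] is an        *)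
(* irreducible right module of [J]; so an ideal from the radical class lies in *)
(* every primitive ideal.                                                      *)

Set Implicit Arguments.
Unset Strict Implicit.
Unset Printing Implicit Defensive.

Import GRing.Theory.
Local Open Scope classical_set_scope.

(** * Novikov identities and R-identities *)

(** Primitive ideals are exactly the cores, i.e. the largest ideals inside, of maximal modular right
    ideals ([primitive_idealP]), so both inclusions come from moving such right ideals between [A]
    and an ideal of [A]. Let [P] be the intersection of the primitive ideals. An irreducible module
    of [P] would give a maximal modular right ideal of [P] ([irreducible_module_modular]), and this
    extends to one of [A] not containing [P] ([maximal_modular_extension]), although [P] lies in its
    core. Conversely, an ideal [J] not contained in a maximal modular right ideal [I] has an
    irreducible module ([ideal_not_radical]), so a radical [J] lies in every such [I] and hence in
    every core. In the semisimple case the projections to the primitive quotients have common kernel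
    [P], which is 0. *)

Section Subspaces.
Variables (F : fieldType) (V : lmodType F) (S : set V).
Hypothesis sS : is_subspace S.

Lemma subspace0 : S 0. Proof. by case: sS. Qed.
Lemma subspaceD x y : S x -> S y -> S (x + y).
Proof. by move=> Sx Sy; rewrite -[x]scale1r; apply: sS.2. Qed.
Lemma subspaceZ c x : S x -> S (c *: x).
Proof. by move=> Sx; rewrite -[_ *: _]addr0; apply: sS.2 => //; apply: subspace0. Qed.
Lemma subspaceB x y : S x -> S y -> S (x - y).
Proof. by move=> Sx Sy; rewrite -scaleN1r addrC; apply: sS.2. Qed.
Lemma subspaceN x : S x -> S (- x).
Proof. by rewrite -sub0r => Sx; apply: subspaceB => //; apply: subspace0. Qed.
Lemma subspace_congr x y : S (x - y) -> S x <-> S y.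
Proof.
move=> Sxy; split=> H; last by rewrite -(subrK y x); apply: subspaceD.
by rewrite -(subKr x y); apply: subspaceB.
Qed.

End Subspaces.

Section Bilinearity.
Variables (F : fieldType) (A : naAlgType F).
Implicit Types x y z : A.

Lemma namulBl x y z : (x - y) *n z = x *n z - y *n z.
Proof. by rewrite namulDl namulNl. Qed.
Lemma namulBr x y z : x *n (y - z) = x *n y - x *n z.
Proof. by rewrite namulDr namulNr. Qed.
Lemma namul0l x : 0 *n x = 0.
Proof. by have := namulZl 0 0 x; rewrite !scale0r. Qed.
Lemma namul0r x : x *n 0 = 0.
Proof. by have := namulZr 0 x 0; rewrite !scale0r. Qed.

End Bilinearity.

Section NovikovIdentities.
Variables (F : fieldType) (A : novikovType F).
Implicit Types x y z a : A.

Lemma associator_linear1 c x y z t :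
  associator (c *: x + y) z t = c *: associator x z t + associator y z t.
Proof.
by rewrite /associator !(namulDl, namulZl) scalerBr opprD addrACA.
Qed.
Lemma associator_linear2 c x y z t :
  associator z (c *: x + y) t = c *: associator z x t + associator z y t.
Proof. by rewrite novikov_lsym associator_linear1 !(novikov_lsym z). Qed.

(** Right multiplications commute, so [a] can be moved past [y], [z] and [y *n z]. *)
Lemma associatorMl x a y z : associator (x *n a) y z = associator x y z *n a.
Proof.
rewrite /associator namulBl (novikov_rcomm x a y) (novikov_rcomm _ a z).
by rewrite (novikov_rcomm x a).
Qed.
Lemma associatorMm x a y z : associator x (y *n a) z = associator x y z *n a.
Proof. by rewrite novikov_lsym associatorMl (novikov_lsym x). Qed.

End NovikovIdentities.

Section Induction.
Variable F : fieldType.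

Lemma free_novikov_ind (P : free_novikov F -> Prop) :
  (forall i, P (free_gen F i)) -> P 0 -> (forall x y, P x -> P y -> P (x + y)) ->
  (forall c x, P x -> P (c *: x)) -> (forall x y, P x -> P y -> P (x *n y)) ->
  forall x, P x.
Proof.
move=> Pg P0 PD PZ PM; elim/pclass_ind.
elim=> [i||t Pt u Pu|c t Pt|t Pt u Pu]; [exact: Pg|exact: P0| | | ].
- by rewrite pclassD; apply: PD.
- by rewrite pclassZ; apply: PZ.
- by rewrite pclassM; apply: PM.
Qed.

Lemma tensor_ind (V : lmodType F) (P : tensor V -> Prop) :
  (forall v, P (tensor_gen v)) -> P (uone (tensor V)) -> P 0 ->
  (forall x y, P x -> P y -> P (x + y)) ->
  (forall c x, P x -> P (c *: x)) -> (forall x y, P x -> P y -> P (x *n y)) ->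
  forall x, P x.
Proof.
move=> Pg P1 P0 PD PZ PM; elim/pclass_ind.
elim=> [[v|]||t Pt u Pu|c t Pt|t Pt u Pu]; [exact: Pg|exact: P1|exact: P0| | | ].
- by rewrite pclassD; apply: PD.
- by rewrite pclassZ; apply: PZ.
- by rewrite pclassM; apply: PM.
Qed.

End Induction.

Section EndoEval.
Variables (F : fieldType) (M : lmodType F).

Lemma endoM (f g : endo M) m : (f *n g) m = g (f m). Proof. by []. Qed.
Lemma endoB (f g : endo M) m : (f - g) m = f m - g m. Proof. by []. Qed.

End EndoEval.

Section RightRepresentations.
Variable F : fieldType.

Section Substitution.
Variable A : novikovType F.
Implicit Types a b : nat -> A.

(** This encodes that finitely many generators occur in [x]; the bound [n] makes [free_gen F n]
    available as a fresh variable. *)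
Lemma free_novikov_hom_local (x : free_novikov F) :
  exists n, forall a b, (forall i, (i < n)%N -> a i = b i) ->
    free_novikov_hom a x = free_novikov_hom b x.
Proof.
elim/free_novikov_ind: x => [i||x y [n Hn] [k Hk]|c x [n Hn]|x y [n Hn] [k Hk]].
- by exists i.+1 => a b; rewrite !free_novikov_hom_gen; apply.
- by exists 0%N => a b _; rewrite !linear0.
- exists (maxn n k) => a b ab; rewrite !linearD /= (Hn a b) ?(Hk a b) //.
    by move=> i lt_i; apply: ab; rewrite leq_max lt_i orbT.
  by move=> i lt_i; apply: ab; rewrite leq_max lt_i.
- by exists n => a b ab; rewrite !linearZ /= (Hn a b).
- exists (maxn n k) => a b ab; rewrite !free_novikov_homM (Hn a b) ?(Hk a b) //.
    by move=> i lt_i; apply: ab; rewrite leq_max lt_i orbT.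
  by move=> i lt_i; apply: ab; rewrite leq_max lt_i.
Qed.

Lemma tensor_substM a x y :
  tensor_subst a (x *n y) = tensor_subst a x *n tensor_subst a y.
Proof. exact: tensor_homM. Qed.
Lemma tensor_substD a x y :
  tensor_subst a (x + y) = tensor_subst a x + tensor_subst a y.
Proof. exact: linearD. Qed.
Lemma tensor_substB a x y :
  tensor_subst a (x - y) = tensor_subst a x - tensor_subst a y.
Proof. exact: linearB. Qed.
Lemma tensor_substZ a c x : tensor_subst a (c *: x) = c *: tensor_subst a x.
Proof. exact: linearZ. Qed.
Lemma tensor_subst0 a : tensor_subst a 0 = 0.
Proof. exact: linear0. Qed.
Lemma tensor_subst1 a : tensor_subst a (uone _) = uone _.
Proof. exact: tensor_hom1. Qed.
Lemma tensor_subst_gen a x :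
  tensor_subst a (tensor_gen x) = tensor_gen (free_novikov_hom a x).
Proof. exact: tensor_hom_gen. Qed.

Lemma tensor_subst_local (G : tensor (free_novikov F)) :
  exists n, forall a b, (forall i, (i < n)%N -> a i = b i) ->
    tensor_subst a G = tensor_subst b G.
Proof.
elim/tensor_ind: G => [x|||x y [n Hn] [k Hk]|c x [n Hn]|x y [n Hn] [k Hk]].
- have [n Hn] := free_novikov_hom_local x.
  by exists n => a b ab; rewrite !tensor_subst_gen (Hn a b).
- by exists 0%N => a b _; rewrite !tensor_subst1.
- by exists 0%N => a b _; rewrite !tensor_subst0.
- exists (maxn n k) => a b ab; rewrite !tensor_substD (Hn a b) ?(Hk a b) //.
    by move=> i lt_i; apply: ab; rewrite leq_max lt_i orbT.
  by move=> i lt_i; apply: ab; rewrite leq_max lt_i.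
- by exists n => a b ab; rewrite !tensor_substZ (Hn a b).
- exists (maxn n k) => a b ab; rewrite !tensor_substM (Hn a b) ?(Hk a b) //.
    by move=> i lt_i; apply: ab; rewrite leq_max lt_i orbT.
  by move=> i lt_i; apply: ab; rewrite leq_max lt_i.
Qed.

(** Substitution is multiplicative, so it intertwines the operators of [G] and of [G(a)]. If [G] is
    an R-identity, [G(a)] therefore kills the image of the substitution. *)
Lemma free_novikov_hom_rmul a (G : tensor (free_novikov F)) g :
  free_novikov_hom a (tensor_hom (@rmul F (free_novikov F)) G g) =
  tensor_hom (@rmul F A) (tensor_subst a G) (free_novikov_hom a g).
Proof.
elim/tensor_ind: G g => [x|||x y Hx Hy|c x Hx|x y Hx Hy] g.
- rewrite tensor_subst_gen !tensor_hom_gen; exact: free_novikov_homM.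
- by rewrite tensor_subst1 !tensor_hom1.
- by rewrite tensor_subst0 !linear0.
- by rewrite tensor_substD !linearD /= -Hx -Hy.
- by rewrite tensor_substZ !linearZ /= -Hx.
- by rewrite tensor_substM !tensor_homM !endoM Hy Hx.
Qed.

(* [G] acts by zero on a generator not occurring in it; specializing that     *)
(* generator to an arbitrary [x] makes [G(a)] kill [x].                       *)
Lemma rmul_right_representation : right_representation (@rmul F A).
Proof.
move=> G a G0; apply: endoP => x.
have [n Hn] := tensor_subst_local G.
pose b i := if (i < n)%N then a i else x.
have -> : tensor_subst a G = tensor_subst b G.
  by apply: Hn => i lt_i; rewrite /b lt_i.
have <- : free_novikov_hom b (free_gen F n) = x.
  by rewrite free_novikov_hom_gen /b ltnn.
by rewrite -free_novikov_hom_rmul G0; apply: linear0.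
Qed.

(** A quotient of the regular right module satisfies every identity of right multiplications,
    because [p] intertwines the two actions. *)
Lemma factor_right_representation (M : lmodType F) (rho : {linear A -> endo M})
    (p : {linear A -> M}) :
  (forall m, exists x, p x = m) -> (forall x (a : A), rho a (p x) = p (x *n a)) ->
  right_representation rho.
Proof.
move=> surj_p rho_p G a G0; apply: endoP => m.
have [x <-] := surj_p m.
suff -> : tensor_hom rho (tensor_subst a G) (p x) =
    p (tensor_hom (@rmul F A) (tensor_subst a G) x).
  by rewrite rmul_right_representation //; apply: linear0.
elim/tensor_ind: (tensor_subst a G) x => [y|||y z Hy Hz|c y Hy|y z Hy Hz] x.
- by rewrite !tensor_hom_gen; apply: rho_p.
- by rewrite !tensor_hom1.
- by rewrite !linear0.
- by rewrite !linearD /= Hy Hz.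
- by rewrite !linearZ /= Hy.
- by rewrite !tensor_homM !endoM Hy Hz.
Qed.

End Substitution.

Section Identities.
Variables (A : novikovType F) (M : lmodType F) (rho : {linear A -> endo M}).
Hypothesis rhoR : right_representation rho.

(** Right commutativity, read as an identity between right multiplications, is an R-identity. *)
Lemma right_representation_comm a b m : rho a (rho b m) = rho b (rho a m).
Proof.
pose g i := tensor_gen (free_gen F i).
pose s i := if i is 0%N then b else a.
pose G := g 0%N *n g 1%N - g 1%N *n g 0%N.
have G0 : R_identity G.
  rewrite /R_identity /G /g linearB /= !tensor_homM !tensor_hom_gen.
  apply: endoP => x; rewrite endoB !endoM.
  by apply/eqP; rewrite subr_eq0; apply/eqP; apply: novikov_rcomm.
have GE : tensor_hom rho (tensor_subst s G) = rho b *n rho a - rho a *n rho b.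
  rewrite /G /g tensor_substB !tensor_substM !tensor_subst_gen !free_novikov_hom_gen.
  by rewrite linearB /= !tensor_homM !tensor_hom_gen.
apply/eqP; rewrite -subr_eq0 -!endoM -endoB -GE rhoR //.
Qed.

(* In the free algebra, [b(x, y) := R_(xy) - R_x R_y] is [z |-> - (z, x, y)],  *)
(* so this is [(z, x y, t) = (z, x, t) y].                                     *)
Lemma right_representation_assoc x y t m :
  rho ((x *n y) *n t) m - rho t (rho (x *n y) m) =
  rho y (rho (x *n t) m - rho t (rho x m)).
Proof.
pose s i := match i with 0%N => x | 1%N => y | _ => t end.
pose X i := free_gen F i.
pose b z u : tensor (free_novikov F) := tensor_gen (z *n u) - tensor_gen z *n tensor_gen u.
pose G := b (X 0%N *n X 1%N) (X 2%N) - b (X 0%N) (X 2%N) *n tensor_gen (X 1%N).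
have bE (B : uaAlgType F) (f : {linear free_novikov F -> B}) z u :
    tensor_hom f (b z u) = f (z *n u) - f z *n f u.
  by rewrite /b linearB /= tensor_homM !tensor_hom_gen.
have sbE z u : tensor_hom rho (tensor_subst s (b z u)) =
    rho (free_novikov_hom s z *n free_novikov_hom s u) -
    rho (free_novikov_hom s z) *n rho (free_novikov_hom s u).
  rewrite /b tensor_substB tensor_substM !tensor_subst_gen free_novikov_homM.
  by rewrite linearB /= tensor_homM !tensor_hom_gen.
have G0 : R_identity G.
  rewrite /R_identity /G linearB /= tensor_homM !bE tensor_hom_gen.
  apply: endoP => z; rewrite endoB endoM !endoB !endoM.
  apply/eqP; rewrite subr_eq0; apply/eqP.
  transitivity (- associator z (X 0%N *n X 1%N) (X 2%N)); first by rewrite opprB.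
  by rewrite associatorMm -namulNl opprB.
have GE : tensor_hom rho (tensor_subst s G) =
    rho ((x *n y) *n t) - rho (x *n y) *n rho t - (rho (x *n t) - rho x *n rho t) *n rho y.
  rewrite /G tensor_substB tensor_substM tensor_subst_gen linearB /= tensor_homM.
  by rewrite !sbE tensor_hom_gen /X free_novikov_homM !free_novikov_hom_gen.
apply/eqP; rewrite -subr_eq0 -[X in X == 0]/((rho ((x *n y) *n t) - rho (x *n y) *n rho t -
  (rho (x *n t) - rho x *n rho t) *n rho y) m) -GE rhoR //.
Qed.
End Identities.
End RightRepresentations.

(** * Irreducible modules and maximal modular right ideals *)

Section LinearOf.
Variables (F : fieldType) (U V : lmodType F).

Lemma linear_of (f : U -> V) : linear f -> exists u : {linear U -> V}, u =1 f.
Proof.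
move=> lf; pose fB := GRing.isLinear.Build F U V *:%R f lf.
by exists (HB.pack_for {linear U -> V} f fB).
Qed.

End LinearOf.

Section QuotientSpace.
Variables (F : fieldType) (V : lmodType F).

(* With the zero multiplication every subspace of [V] is an ideal, so the     *)
(* quotient algebra construction also yields quotient spaces.                 *)
Definition zero_alg : Type := V.
HB.instance Definition _ := GRing.Lmodule.on zero_alg.

Definition zero_mul (x y : zero_alg) : zero_alg := 0.

Fact zero_mulDl : left_distributive zero_mul +%R.
Proof. by move=> x y z; rewrite /zero_mul addr0. Qed.
Fact zero_mulDr : right_distributive zero_mul +%R.
Proof. by move=> x y z; rewrite /zero_mul addr0. Qed.
Fact zero_mulZl c x y : zero_mul (c *: x) y = c *: zero_mul x y.
Proof. by rewrite /zero_mul scaler0. Qed.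
Fact zero_mulZr c x y : zero_mul x (c *: y) = c *: zero_mul x y.
Proof. by rewrite /zero_mul scaler0. Qed.

HB.instance Definition _ := Lmodule_isNaAlgebra.Build F zero_alg
  zero_mulDl zero_mulDr zero_mulZl zero_mulZr.

Lemma quotient_space (S : set V) : is_subspace S ->
  exists (M : lmodType F) (p : {linear V -> M}),
    (forall m, exists x, p x = m) /\ (forall x, p x = 0 <-> S x).
Proof.
move=> sS.
have iS : @is_ideal F zero_alg S.
  by split; split=> // x y _; apply: subspace0 sS.
have [|p pE] := @linear_of F V (quot_alg (Ideal iS)) (@qclass F zero_alg (Ideal iS)).
  by move=> c x y; exact: (@qclass_linear F zero_alg (Ideal iS) c x y).
exists (quot_alg (Ideal iS)), p.
split=> [m|x]; first by exists (repr m); rewrite pE; apply: qclassK.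
rewrite pE -(linear0 (@qclass F zero_alg (Ideal iS))).
by apply: iff_trans (qclassP _ _ _) _; rewrite subr0.
Qed.

End QuotientSpace.

Section Modular.
Variable F : fieldType.

(** The second modularity condition in terms of elements. Commutativity modulo [I] turns a right
    ideal into an ideal and a left unit into a unit. *)
Definition commutative_unital_mod (A : naAlgType F) (I : set A) : Prop :=
  (forall x y, I (x *n y - y *n x)) /\ (exists u, forall x, I (u *n x - x)).

Lemma commutative_unital_quot (A : naAlgType F) (J : ideal A) :
  commutative_unital (quot_alg J) <-> commutative_unital_mod J.
Proof.
split=> -[comm [u uP]]; split.
- by move=> x y; apply/qclassP; rewrite !qclassM.
- exists (repr u) => x; apply/qclassP; rewrite qclassM qclassK.
  by case: (uP (qclass J x)).
- elim/qclass_ind=> x; elim/qclass_ind=> y; rewrite -!qclassM.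
  exact/qclassP.
- exists (qclass J u); elim/qclass_ind=> x; rewrite -!qclassM.
  split; apply/qclassP => //; rewrite -(subrKA (u *n x)).
  exact: idealD.
Qed.

Lemma commutative_mod_ideal (A : naAlgType F) (I : set A) :
  is_right_ideal I -> (forall x y, I (x *n y - y *n x)) -> is_ideal I.
Proof.
move=> [sI rI] comm; split=> //; split=> // x y Ix.
by apply/(subspace_congr sI (comm y x)); apply: rI.
Qed.

Lemma right_idealT (A : naAlgType F) : @is_right_ideal F A setT.
Proof. by []. Qed.

Lemma is_modularP (A : naAlgType F) (I : set A) :
  is_right_ideal I -> I <> setT ->
  is_modular I <->
  (exists e f, forall a, I (a - associator a e f)) \/ commutative_unital_mod I.
Proof.
move=> rI properI; split.
  case=> _ _ [?|[J -> /commutative_unital_quot ?]]; first by left.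
  by right.
case=> [?|cuI]; split=> //; first by left.
right; exists (Ideal (commutative_mod_ideal rI cuI.1)) => //.
exact/commutative_unital_quot.
Qed.

(** The form in which maximality is used: a right ideal [J] defined by some condition contains [I]
    and one element outside it, so the condition holds everywhere. *)
Lemma maximal_right_ideal_top (A : naAlgType F) (I J : set A) x :
  is_maximal_right_ideal I -> is_right_ideal J -> I `<=` J -> J x -> ~ I x ->
  forall y, J y.
Proof.
move=> [_ _ maxI] rJ IJ Jx nIx y; apply: contrapT => nJy.
have : J <> setT by move=> JT; apply: nJy; rewrite JT.
by move=> /(maxI _ rJ)/(_ IJ) JI; apply: nIx; rewrite -JI.
Qed.

Lemma maximal_right_ideal_of (A : naAlgType F) (I : set A) :
  is_right_ideal I -> (exists x, ~ I x) ->
  (forall J x, is_right_ideal J -> I `<=` J -> J x -> ~ I x -> forall y, J y) ->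
  is_maximal_right_ideal I.
Proof.
move=> rI [x0 nIx0] maxI; split=> // [IT|J rJ JT IJ]; first by apply: nIx0; rewrite IT.
apply/seteqP; split=> // x Jx; apply: contrapT => nIx.
by apply: JT; apply/seteqP; split=> // y _; apply: maxI nIx y.
Qed.

End Modular.

Section IrreducibleModules.
Variables (F : fieldType) (A : novikovType F).

Section Schur.
Variables (M : lmodType F) (rho : {linear A -> endo M}).
Hypothesis irrM : irreducible_module rho.

Lemma irreducible_submodule_top (N : set M) m :
  is_submodule rho N -> N m -> m <> 0 -> forall n, N n.
Proof.
move=> sN Nm m0 n; case: (irrM.1 N sN) => NE; last by rewrite NE.
by rewrite NE in Nm.
Qed.

(** Schur's lemma: the kernel of an endomorphism commuting with the action is a submodule. *)
Lemma irreducible_commutant_zero (f : endo M) m :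
  (forall a n, f (rho a n) = rho a (f n)) -> f m = 0 -> m <> 0 ->
  forall n, f n = 0.
Proof.
move=> f_rho fm0; apply: (@irreducible_submodule_top [set n | f n = 0]) => //.
split; first split=> [|c x y /= fx fy]; rewrite /= ?linear0 //.
  by rewrite linearP fx fy scaler0 addr0.
by move=> x a /= fx; rewrite f_rho fx linear0.
Qed.

Section ModuleMap.
Variable u : {linear A -> M}.
Hypothesis u_rho : forall x a, u (x *n a) = rho a (u x).

Lemma image_submodule (J : set A) : is_right_ideal J -> is_submodule rho (u @` J).
Proof.
move=> [sJ rJ]; split; first split.
- by exists 0; [apply: subspace0 sJ | rewrite linear0].
- move=> c _ _ [x Jx <-] [y Jy <-].
  by exists (c *: x + y); [apply: sJ.2 | rewrite linearP].
- by move=> _ a [x Jx <-]; exists (x *n a); [apply: rJ | apply: u_rho].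
Qed.

Lemma module_map_onto (J : set A) x :
  is_right_ideal J -> J x -> u x <> 0 -> forall m, exists2 y, J y & u y = m.
Proof.
move=> rJ Jx ux0 m; have := @irreducible_submodule_top (u @` J) (u x).
by move=> /(_ (image_submodule rJ)) H; apply: H => //; exists x.
Qed.

(** A right ideal strictly above the kernel is mapped onto [M], so it contains every element up to
    an element of the kernel. *)
Lemma kernel_maximal_right_ideal x0 : u x0 <> 0 ->
  is_maximal_right_ideal [set x | u x = 0].
Proof.
move=> ux0; apply: maximal_right_ideal_of; last 1 first.
- move=> J x rJ IJ Jx nux y.
  have [z Jz uz] := module_map_onto rJ Jx nux (u y).
  by apply/(subspace_congr rJ.1 (y := z)); first by apply: IJ; rewrite /= linearB uz /= subrr.
- split; first split=> [|c x y /= ux uy]; rewrite /= ?linear0 //.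
    by rewrite linearP ux uy scaler0 addr0.
  by move=> x y /= ux; rewrite u_rho ux linear0.
- by exists x0.
Qed.

End ModuleMap.
End Schur.

(* Put [b(x, y) := rho (x y) - rho x rho y].  If [b] vanishes then [rho] is a *)
(* homomorphism and its kernel works.  Otherwise the kernel of                *)
(* [x |-> m b(x, y0)] works, because [(a, e, f)] is sent to                   *)
(* [- m b(a, y0) b(e, f)] and [e] can be chosen with [b(e, y0) = -1].         *)
Lemma irreducible_module_modular (M : lmodType F) (rho : {linear A -> endo M}) :
  right_representation rho -> irreducible_module rho ->
  exists I : set A, is_maximal_right_ideal I /\ is_modular I.
Proof.
move=> rhoR irrM.
have rhoC := right_representation_comm rhoR.
have rhoA := right_representation_assoc rhoR.
pose b x y : endo M := rho (x *n y) - rho x *n rho y.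
have bE x y m : b x y m = rho (x *n y) m - rho y (rho x m) by [].
have rho_linear c x y m : rho (c *: x + y) m = c *: rho x m + rho y m.
  by rewrite linearP.
have bC x y a m : b x y (rho a m) = rho a (b x y m).
  by rewrite !bE linearB /= (rhoC _ a) (rhoC x a) (rhoC y a).
have [b0|/existsNP[x0 /existsNP[y0 /existsNP[m bm]]]] :=
  pselect (forall x y m, b x y m = 0).
- have rhoM x y m : rho (x *n y) m = rho y (rho x m).
    by apply/eqP; rewrite -subr_eq0 -bE b0.
  have [m [a0 am]] := irrM.2.
  have [|u uE] := @linear_of F A M (fun x => rho x m).
    by move=> c x y; rewrite linearP.
  have u_rho x a : u (x *n a) = rho a (u x) by rewrite !uE rhoM.
  have m0 : m <> 0 by move=> m0; apply: am; rewrite m0 linear0.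
  have ua0 : u a0 <> 0 by rewrite uE.
  have maxI := kernel_maximal_right_ideal irrM u_rho ua0.
  exists [set x | u x = 0]; split=> //; apply/is_modularP; [by case: maxI..|].
  right; split=> [x y|]; first by rewrite /= linearB /= !uE !rhoM rhoC subrr.
  (* Some [e] fixes [m], so [m(e x) = (m e) x = m x] and [e] is a left unit modulo the kernel. *)
  have [e _ em] := module_map_onto irrM u_rho (J := setT) (x := a0) (right_idealT A) I ua0 m.
  by exists e => x /=; rewrite linearB /= u_rho em uE subrr.
- have m0 : m <> 0 by move=> m0; apply: bm; rewrite m0 linear0.
  have [|u uE] := @linear_of F A M (fun x => b x y0 m).
    move=> c x y; rewrite !bE namulDl namulZl !rho_linear linearP scalerBr opprD.
    by rewrite addrACA.
  have u_rho x a : u (x *n a) = rho a (u x) by rewrite !uE !bE rhoA.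
  have ux0 : u x0 <> 0 by rewrite uE.
  have maxI := kernel_maximal_right_ideal irrM u_rho ux0.
  exists [set x | u x = 0]; split=> //; apply/is_modularP; [by case: maxI..|left].
  have [e _ em] := module_map_onto irrM u_rho (J := setT) (x := x0) (right_idealT A) I ux0 (- m).
  (* The operator [b e y0 + 1] commutes with the action and kills [m], so it vanishes by Schur's
     lemma. *)
  have be n : b e y0 n + n = 0.
    apply: (irreducible_commutant_zero irrM (f := b e y0 + uone _) (m := m)) => //.
      by move=> a n'; rewrite -[LHS]/(b e y0 (rho a n') + rho a n') bC -linearD.
    by rewrite -[LHS]/(b e y0 m + m) -uE em addNr.
  exists e, y0 => a /=; rewrite linearB /associator linearB /= !u_rho.
  by rewrite -[RHS](be (u a)) bE opprB addrC.
Qed.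

(** The irreducible module is [A / I]: its submodules pull back to right ideals above [I], and
    [x0 *n a0] shows that the action is not zero. *)
Lemma maximal_right_ideal_not_radical (I : set A) x0 a0 :
  is_maximal_right_ideal I -> ~ I (x0 *n a0) -> ~ radical_class A.
Proof.
move=> maxI nI0 radA; have [[sI rI] _ _] := maxI.
have [M [p [surj_p ker_p]]] := quotient_space sI.
(* [s] is only a set-theoretic section; [p_mulr] makes the action independent of it and linear. *)
have /choice[s sK] := surj_p.
have p_mulr x y a : p x = p y -> p (x *n a) = p (y *n a).
  move=> pxy; apply/eqP; rewrite -subr_eq0 -linearB -namulBl /=; apply/eqP/ker_p/rI/ker_p.
  by rewrite linearB /= pxy subrr.
pose r a m := p (s m *n a).
have r_linear a : linear (r a).
  move=> c m n; rewrite /r -linearP -namulZl -namulDl; apply: p_mulr.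
  by rewrite linearP !sK.
have /choice[rho0 rho0E] := fun a => linear_of (r_linear a).
have [|rho rho_r] := @linear_of F A (endo M) rho0.
  move=> c a b; apply: endoP => m; rewrite -[RHS]/(c *: rho0 a m + rho0 b m).
  by rewrite !rho0E /r namulDr namulZr linearP.
have rhoE x a : rho a (p x) = p (x *n a).
  by rewrite rho_r rho0E; apply: p_mulr; rewrite sK.
apply: (radA M rho); first exact: factor_right_representation surj_p rhoE.
split; last by exists (p x0), a0; rewrite rhoE => /ker_p.
move=> N [sN rN]; have [N0|] := pselect (N `<=` [set 0]).
  left; apply/seteqP; split=> // _ ->; exact: subspace0 sN.
move=> /existsNP[n /not_implyP[Nn n0]]; right; apply/seteqP; split=> // m _.
have [[x <-] [y yn]] := (surj_p m, surj_p n).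
apply: (@maximal_right_ideal_top _ _ I (p @^-1` N) y maxI) => //=.
- split; first split=> [|c z t /= Nz Nt]; rewrite /= ?linear0; first exact: subspace0 sN.
    by rewrite linearP; apply: sN.2.
  by move=> z t /= Nz; rewrite -rhoE; apply: rN.
- by move=> z /ker_p /= ->; apply: subspace0 sN.
- by rewrite yn.
- by move=> /ker_p; rewrite yn.
Qed.

End IrreducibleModules.

(** * Extending maximal modular right ideals from an ideal *)

Section RelativeIdeals.
Variables (F : fieldType) (A : novikovType F).

(* Right ideals of the ideal [P], as subsets of the ambient algebra.          *)
Definition right_ideal_in (P I : set A) : Prop :=
  [/\ is_subspace I, I `<=` P & forall x y, I x -> P y -> I (x *n y)].

Definition maximal_right_ideal_in (P I : set A) : Prop :=
  [/\ right_ideal_in P I, exists2 x, P x & ~ I x &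
    forall S x, right_ideal_in P S -> I `<=` S -> S x -> ~ I x -> P `<=` S].

Variable P : ideal A.

Lemma ideal_subspace : is_subspace P. Proof. by case: (idealP P) => -[]. Qed.

Lemma ideal_alg_in (y : ideal_alg P) : ideal_set P (\val y).
Proof. by have /asboolP := valP y. Qed.

Lemma ideal_alg_lift x : ideal_set P x -> exists y : ideal_alg P, \val y = x.
Proof. by move=> Px; exists (Sub x (asboolT Px)); apply: SubK. Qed.

Lemma image_val_in (I : set (ideal_alg P)) y : (val @` I) (\val y) <-> I y.
Proof. by split=> [[z Iz /val_inj <-]|Iy] //; exists y. Qed.

Lemma image_right_ideal_in (I : set (ideal_alg P)) :
  is_right_ideal I -> right_ideal_in P (val @` I).
Proof.
move=> [sI rI]; split; first split.
- by exists 0; [apply: subspace0 sI | apply: linear0].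
- move=> c _ _ [x Ix <-] [y Iy <-].
  by exists (c *: x + y); [apply: sI.2 | apply: linearP].
- by move=> _ [x _ <-]; apply: ideal_alg_in.
- move=> _ _ [x Ix <-] /ideal_alg_lift[y <-].
  by exists (x *n y); first exact: rI.
Qed.

Lemma preimage_val_right_ideal (S : set A) :
  right_ideal_in P S -> is_right_ideal [set y : ideal_alg P | S (\val y)].
Proof.
move=> [sS SP rS]; split; first split.
- exact: subspace0 sS.
- by move=> c x y; apply: sS.2.
- by move=> x y Sx; apply: rS => //; apply: ideal_alg_in.
Qed.

Lemma image_maximal_right_ideal_in (I : set (ideal_alg P)) :
  is_maximal_right_ideal I -> maximal_right_ideal_in P (val @` I).
Proof.
move=> maxI; have [rI properI _] := maxI; split.
- exact: image_right_ideal_in.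
- apply: contrapT => noP; apply: properI; apply/seteqP; split=> // y _.
  apply: contrapT => nIy; apply: noP; exists (\val y); first exact: ideal_alg_in.
  by move/image_val_in.
- move=> S x rS IS Sx nIx _ /ideal_alg_lift[z <-].
  have [_ SP _] := rS; have [y yx] := ideal_alg_lift (SP _ Sx).
  apply: (maximal_right_ideal_top maxI (preimage_val_right_ideal rS) (x := y)).
  - by move=> t It; apply: IS; exists t.
  - by rewrite /= yx.
  - by move=> Iy; apply: nIx; rewrite -yx; apply/image_val_in.
Qed.

Lemma preimage_maximal_right_ideal (S : set A) :
  maximal_right_ideal_in P S ->
  is_maximal_right_ideal [set y : ideal_alg P | S (\val y)].
Proof.
move=> [rS [x0 Px0 nSx0] maxS]; apply: maximal_right_ideal_of.
- exact: preimage_val_right_ideal.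
- by have [y yx] := ideal_alg_lift Px0; exists y; rewrite /= yx.
- move=> J x rJ SJ Jx /= nSx y; apply/image_val_in.
  apply: (maxS _ (\val x) (image_right_ideal_in rJ)) => //.
  + move=> z Sz; have [_ SP _] := rS; have [t tz] := ideal_alg_lift (SP _ Sz).
    by rewrite -tz; apply/image_val_in/SJ; rewrite /= tz.
  + exact: ideal_alg_in.
Qed.

End RelativeIdeals.

Section Extension.
Variables (F : fieldType) (A : novikovType F) (P : ideal A) (I : set A).
Hypothesis maxI : maximal_right_ideal_in P I.

Let rI : right_ideal_in P I. Proof. by case: maxI. Qed.
Let sI : is_subspace I. Proof. by case: rI. Qed.
Let IP : I `<=` P. Proof. by case: rI. Qed.
Let rIP x y : I x -> ideal_set P y -> I (x *n y). Proof. by case: rI => _ _; apply. Qed.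

(* [phi] is the identity modulo [I] on [P]; it retracts [A] onto [P / I].     *)
Section Retraction.
Variable phi : A -> A.
Hypothesis phi_linear : linear phi.
Hypothesis phiM : forall a b, phi (a *n b) = phi a *n b.
Hypothesis phiP : forall a, ideal_set P (phi a).
Hypothesis phi_id : forall p, ideal_set P p -> I (p - phi p).
Hypothesis phi_stable : forall (J : set A) a, is_right_ideal J -> J a -> J (phi a).
Hypothesis IA : forall x a, I x -> I (x *n a).

Lemma retraction_sub_mod a : I (phi (a - phi a)).
Proof.
by rewrite addrC -scaleN1r phi_linear scaleN1r addrC; apply: phi_id.
Qed.

Lemma retraction_in p : ideal_set P p -> I p <-> I (phi p).
Proof. by move=> Pp; apply: subspace_congr => //; apply: phi_id. Qed.

(** If a right ideal [J] contains the preimage of [I] and some [x] outside it, then [J :&: P]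
    contains [I] and [phi x], so [J] contains [P] by maximality of [I]. Every [y] is then in [J],
    being [phi y] plus an element of the preimage. *)
Lemma retraction_maximal :
  is_maximal_right_ideal (phi @^-1` I) /\ (exists2 p, ideal_set P p & ~ I (phi p)).
Proof.
have [_ [p Pp nIp] topI] := maxI.
have nIphi : ~ I (phi p) by move/(retraction_in Pp).
split; last by exists p.
apply: maximal_right_ideal_of.
- split; first split=> [|c x y Ix Iy] /=.
  + have := phi_linear (-1) 0 0; rewrite scaler0 addr0 scaleN1r addNr => ->.
    exact: subspace0 sI.
  + by rewrite phi_linear; apply: sI.2.
  + by move=> x y Ix /=; rewrite phiM; apply: IA.
- by exists p.
- move=> J x rJ IJ Jx nIx y.
  have PJ : P `<=` J.
    have rJP : right_ideal_in P (J `&` P).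
      split; first split.
      + by split; [apply: subspace0 rJ.1 | apply: ideal0].
      + by move=> c s t [Js Ps] [Jt Pt]; split; [apply: rJ.1.2 | apply: idealS].
      + by move=> s [].
      + by move=> s t [Js Ps] Pt; split; [apply: rJ.2 | apply: idealMl].
    move=> z Pz; suff [] : (J `&` P) z by [].
    apply: (topI _ (phi x) rJP) => //.
    + move=> s Is; have Ps := IP Is; split=> //.
      by apply: IJ; apply/(retraction_in Ps).
    + by split; [apply: phi_stable | apply: phiP].
  apply/(subspace_congr rJ.1 (y := phi y)); last exact/PJ/phiP.
  exact/IJ/retraction_sub_mod.
Qed.

End Retraction.

Lemma modular_extension_associator e f :
  ideal_set P e -> ideal_set P f -> (forall a, ideal_set P a -> I (a - associator a e f)) ->
  exists I' : set A, [/\ is_maximal_right_ideal I', is_modular I' &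
    exists2 p, ideal_set P p & ~ I' p].
Proof.
move=> Pe Pf ef.
pose phi a := associator a e f.
have phi_linear : linear phi by move=> c x y; apply: associator_linear1.
have phiM a b : phi (a *n b) = phi a *n b by apply: associatorMl.
have phiP a : ideal_set P (phi a).
  by apply: (subspaceB (ideal_subspace P)); do 2?apply: idealMl.
have phi_stable (J : set A) a : is_right_ideal J -> J a -> J (phi a).
  by move=> [sJ ridealJ] Ja; apply: (subspaceB sJ); do 2?apply: (ridealJ).
(* Modulo [I], [x a] is [(x a, e, f) = (x, e, f) a = (x, e a, f)], and [e a] lies in [P]. *)
have IA x a : I x -> I (x *n a).
  move=> Ix; apply/(subspace_congr sI (ef _ (Defs.idealMr a (IP Ix)))).
  rewrite associatorMl -associatorMm /associator; apply: subspaceB => //.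
    by apply: rIP => //; apply: rIP => //; apply: Defs.idealMr.
  by apply: rIP => //; apply: idealMl.
have [maxI' [p Pp nIp]] := retraction_maximal phi_linear phiM phiP ef phi_stable IA.
exists (phi @^-1` I); split=> //; last by exists p.
apply/is_modularP; [by case: maxI'..|left; exists e, f => a].
exact: (retraction_sub_mod phi_linear phiP ef).
Qed.

(** Here [phi a = a e]. It is multiplicative modulo [I], so commutativity and the unit of [P / I]
    pull back to [A]. *)
Lemma modular_extension_unit e :
  (forall x y, ideal_set P x -> ideal_set P y -> I (x *n y - y *n x)) ->
  ideal_set P e -> (forall x, ideal_set P x -> I (e *n x - x)) ->
  exists I' : set A, [/\ is_maximal_right_ideal I', is_modular I' &
    exists2 p, ideal_set P p & ~ I' p].
Proof.
move=> comm Pe eP.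
have sP := ideal_subspace P.
have cong x y : I (x - y) -> I x <-> I y by apply: subspace_congr.
have congC x y : I (x - y) -> I (y - x).
  by move=> /(subspaceN sI); rewrite opprB.
have congT x y z : I (x - y) -> I (y - z) -> I (x - z).
  by move=> xy yz; rewrite -(subrKA y); apply: subspaceD.
have Pe' x : ideal_set P x -> I (x - x *n e).
  by move=> Px; apply: congT (comm _ _ Pe Px); apply/congC/eP.
have lI x y : ideal_set P y -> I x -> I (y *n x).
  move=> Py Ix; apply/(cong _ _ (comm _ _ Py (IP Ix))); exact: rIP.
(* Modulo [I], [a x] is [(a x) e = (a e) x], with [a e] in [P]. *)
have AI a x : I x -> I (a *n x).
  move=> Ix; have Px := IP Ix; apply/(cong _ _ (Pe' _ (idealMl a Px))).
  by rewrite novikov_rcomm; apply: lI => //; apply: idealMl.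
(* Modulo [I], [x a] is [(x a) e], which left symmetry expands as [(a x) e - a (x e) + x (a e)]. *)
have IA x a : I x -> I (x *n a).
  move=> Ix; have Px := IP Ix; apply/(cong _ _ (Pe' _ (Defs.idealMr a Px))).
  have := novikov_lsym x a e; rewrite /associator => /eqP; rewrite subr_eq => /eqP ->.
  apply: subspaceD => //; last by apply: rIP => //; apply: idealMl.
  apply: subspaceB => //; first by apply: rIP => //; apply: AI.
  by apply/AI/rIP.
pose phi a := a *n e.
have phi_linear : linear phi by move=> c x y; rewrite /phi namulDl namulZl.
have phiM a b : phi (a *n b) = phi a *n b by apply: novikov_rcomm.
have phiP a : ideal_set P (phi a) by apply: idealMl.
have phi_stable (J : set A) a : is_right_ideal J -> J a -> J (phi a).
  by move=> [sJ rJ] Ja; apply: rJ.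
have congMl x y a : I (x - y) -> I (x *n a - y *n a).
  by rewrite -namulBl; apply: IA.
have congMr x y a : I (x - y) -> I (a *n x - a *n y).
  by rewrite -namulBr; apply: AI.
have [maxI' [p Pp nIp]] := retraction_maximal phi_linear phiM phiP Pe' phi_stable IA.
(* Left symmetry replaces [(q, e, b)] by [(e, q, b)], which is 0 modulo [I] because [e] is a left
   unit on [P]. *)
have mul_unit q b : ideal_set P q -> I (q *n b - q *n (e *n b)).
  move=> Pq; apply: (congT _ _ _ (congMl _ _ b (Pe' _ Pq))).
  rewrite -[X in I X]/(associator q e b) novikov_lsym.
  apply: (congT _ _ _ (congMl _ _ b (eP _ Pq))).
  exact/congC/eP/Defs.idealMr.
(* Similarly [(e, b, e) = (b, e, e)] is 0 modulo [I], so [(e b) e] agrees with [e (b e)]. *)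
have unitC b : I (e *n b - b *n e).
  have Pbe : ideal_set P (b *n e) by apply: idealMl.
  apply: (congT _ _ _ (Pe' _ (Defs.idealMr b Pe))).
  apply: (congT _ (e *n (b *n e))); last exact: eP.
  rewrite -[X in I X]/(associator e b e) novikov_lsym.
  apply: (congT _ _ _ (congC _ _ (Pe' _ Pbe))).
  exact/congMr/Pe'.
exists (phi @^-1` I); split=> //; last by exists p.
apply/is_modularP; [by case: maxI'..|right].
have phi_mul a b : I (phi (a *n b) - phi a *n phi b).
  rewrite phiM; apply: (congT _ _ _ (mul_unit _ _ (phiP a))).
  exact/congMr/unitC.
split=> [a b|].
  rewrite /= /phi namulBl; apply: (congT _ _ _ (phi_mul a b)).
  apply: congT (congC _ _ (phi_mul b a)).
  exact: comm.
exists e => a; rewrite /= /phi namulBl; apply: (congT _ _ _ (phi_mul e a)).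
apply: congT (eP _ (phiP a)).
by apply: congMl; apply: eP.
Qed.

End Extension.

(** * Restricting to an ideal, cores and quotients *)

Section Restriction.
Variables (F : fieldType) (A : novikovType F) (J : ideal A) (I : set A).
Hypotheses (maxI : is_maximal_right_ideal I) (modI : is_modular I).
Hypothesis nJI : exists2 s, ideal_set J s & ~ I s.

Let rI : is_right_ideal I. Proof. by case: maxI. Qed.
Let sI : is_subspace I. Proof. by case: rI. Qed.

Lemma right_ideal_top (T : set A) x :
  is_right_ideal T -> I `<=` T -> T x -> ~ I x -> forall y, T y.
Proof. exact: maximal_right_ideal_top maxI. Qed.

(** Suppose [A J] lies in [I]. With a unit [u] modulo [I], [s] agrees with [u s], which is in [I].
    Otherwise the right ideal of all [e'] with [(A, e', f)] inside [I] contains [I] and [s], hence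
    [e], so [s] agrees with [(s, e, f)], again in [I]. *)
Lemma modular_not_absorbing : exists a j, ideal_set J j /\ ~ I (a *n j).
Proof.
have [s Js nIs] := nJI.
apply: contrapT => noAJ.
have AJ a j : ideal_set J j -> I (a *n j).
  by move=> Jj; apply: contrapT => nI; apply: noAJ; exists a, j.
have [_ properI _] := maxI.
case/(is_modularP rI properI): modI => [[e [f ef]]|[_ [u uP]]]; last first.
  by apply: (nIs); apply/(subspace_congr sI (uP s)); apply: AJ.
pose T := [set e' | forall a, I (associator a e' f)].
have rT : is_right_ideal T.
  split; first split=> [a|c x y Tx Ty a].
  - rewrite novikov_lsym /associator !namul0l subr0; exact: subspace0 sI.
  - by rewrite associator_linear2; apply: sI.2.
  - by move=> x y Tx a; rewrite associatorMm; apply: rI.2.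
have IT : I `<=` T.
  move=> x Ix a; rewrite novikov_lsym.
  by apply: (subspaceB sI); do 2?apply: (rI.2).
have Ts : T s.
  move=> a; apply: (subspaceB sI); first by apply: (rI.2); apply: AJ.
  by apply: AJ; apply: Defs.idealMr.
apply: (nIs); apply/(subspace_congr sI (ef s)).
by have := right_ideal_top rT IT Ts nIs e; apply.
Qed.

(* [psi] sends [j] to [(s, j, z)] for some [z \in J], or to [s j] if          *)
(* [(A, A, J) <= I].                                                          *)
Lemma ideal_parametrization s : ~ I s -> exists psi : A -> A,
  [/\ linear psi,
      forall j b, ideal_set J j -> exists2 k, ideal_set J k & I (psi j *n b - psi k),
      exists2 j, ideal_set J j & ~ I (psi j) &
      forall S, right_ideal_in J S -> (forall j, ideal_set J j -> S (s *n j)) ->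
        forall j, ideal_set J j -> S (psi j)].
Proof.
move=> nIs; have [t Jt nIt] := nJI.
have [AAJ|] := pselect (forall a y z, ideal_set J z -> I (associator a y z)).
  exists (fun j => s *n j); split=> //.
  - by move=> c x y; rewrite namulDr namulZr.
  - move=> j b Jj; exists (b *n j); first exact: idealMl.
    by rewrite novikov_rcomm; apply: AAJ.
  (* If [s J] were inside [I], the right ideal of all [x] with [x J] inside [I] would be [A]. *)
  - apply: contrapT => sJ.
    have [a [j [Jj nIaj]]] := modular_not_absorbing.
    pose T := [set x | forall j, ideal_set J j -> I (x *n j)].
    have rT : is_right_ideal T.
      split; first split=> [j' _|c x y Tx Ty j' Jj'].
      + rewrite namul0l; exact: subspace0 sI.
      + by rewrite namulDl namulZl; apply: sI.2; [apply: Tx | apply: Ty].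
      + by move=> x b Tx j' Jj'; rewrite novikov_rcomm; apply: rI.2; apply: Tx.
    apply: nIaj; apply: (right_ideal_top rT _ _ nIs) => //.
      by move=> x Ix j' _; apply: rI.2.
    by move=> j' Jj'; apply: contrapT => nI; apply: sJ; exists j'.
move=> /existsNP[a0 /existsNP[y0 /existsNP[z /not_implyP[Jz nIz]]]].
(* Maximality is applied twice: first to replace [a0] by [s], then to find the middle argument
   inside [J]. *)
have top1 : exists y, ~ I (associator s y z).
  apply: contrapT => none.
  pose T := [set x | forall y, I (associator x y z)].
  apply: nIz; apply: (right_ideal_top (T := T) _ _ _ nIs).
  - split; first split=> [y|c x x' Tx Tx' y].
    + rewrite /associator !namul0l subr0; exact: subspace0 sI.
    + by rewrite associator_linear1; apply: sI.2.
    + by move=> x b Tx y; rewrite associatorMl; apply: rI.2.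
  - by move=> x Ix y; apply: (subspaceB sI); do 2?apply: (rI.2).
  - by move=> y; apply: contrapT => nI; apply: none; exists y.
have [y nIy] := top1.
exists (fun j => associator s j z); split.
- by move=> c x x'; apply: associator_linear2.
- move=> j b Jj; exists (j *n b); first exact: Defs.idealMr.
  by rewrite associatorMm subrr; apply: subspace0 sI.
- apply: contrapT => none.
  pose T := [set x | I (associator s x z)].
  apply: nIy; apply: (right_ideal_top (T := T) (x := t)) => //.
  + split; first split=> [|c x x' Tx Tx'].
    * rewrite /T /= novikov_lsym /associator !namul0l subr0; exact: subspace0 sI.
    * by rewrite /T /= associator_linear2; apply: sI.2.
    * by move=> x b Tx; rewrite /T /= associatorMm; apply: rI.2.
  + move=> x Ix; rewrite /T /= novikov_lsym.
    by apply: (subspaceB sI); do 2?apply: (rI.2).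
  + by apply: contrapT => nI; apply: none; exists t.
- move=> S [sS _ rS] sJ j Jj; apply: (subspaceB sS).
    by apply: rS => //; apply: sJ.
  by apply/sJ/idealMl.
Qed.

(** The set [psi(J) + I] is a right ideal strictly above [I]. *)
Lemma ideal_parametrization_onto (psi : A -> A) : linear psi ->
  (forall j b, ideal_set J j -> exists2 k, ideal_set J k & I (psi j *n b - psi k)) ->
  (exists2 j, ideal_set J j & ~ I (psi j)) ->
  forall x, exists2 j, ideal_set J j & I (x - psi j).
Proof.
move=> psi_linear psiM [j0 Jj0 nI0].
have psi0 : psi 0 = 0.
  by have := psi_linear (-1) 0 0; rewrite scaler0 addr0 scaleN1r addNr.
apply: (right_ideal_top (T := [set x | exists2 j, ideal_set J j & I (x - psi j)])
  (x := psi j0)) => //.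
- split; first split=> [|c x y [j Jj Ij] [k Jk Ik]].
  + by exists 0; [apply: ideal0 | rewrite psi0 subr0; apply: subspace0 sI].
  + exists (c *: j + k); first exact: idealS.
    by rewrite psi_linear opprD addrACA -scalerBr; apply: sI.2.
  + move=> x b [j Jj Ij]; have [k Jk Ik] := psiM j b Jj; exists k => //.
    rewrite -(subrKA (psi j *n b)); apply: (subspaceD sI) => //.
    by rewrite -namulBl; apply: rI.2.
- move=> x Ix; exists 0; first exact: ideal0.
  by rewrite psi0 subr0.
- by exists j0 => //; rewrite subrr; apply: subspace0 sI.
Qed.

Lemma right_ideal_in_setI : right_ideal_in J (I `&` J).
Proof.
split; first split.
- by split; [apply: subspace0 sI | apply: ideal0].
- by move=> c s t [Is Js] [It Jt]; split; [apply: sI.2 | apply: idealS].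
- by move=> s [].
- by move=> s t [Is Js] Jt; split; [apply: rI.2 | apply: idealMl].
Qed.

(** For [s] in [S] outside [I], [S] contains [psi(J)], and every [x] in [J] differs from some
    [psi j] by an element of [I :&: J]. *)
Lemma maximal_right_ideal_in_setI : maximal_right_ideal_in J (I `&` J).
Proof.
split; first exact: right_ideal_in_setI.
  by have [s Js nIs] := nJI; exists s => // -[].
move=> S s rS IS Ss nIs x Jx; have [sS SJ rSJ] := rS.
have [|psi [psi_linear psiM psi_out psi_in]] := @ideal_parametrization s.
  by move=> Is; apply: (nIs); split=> //; apply: SJ.
have [j Jj Ij] := ideal_parametrization_onto psi_linear psiM psi_out x.
have Spsi : S (psi j) by apply: psi_in => // k Jk; apply: rSJ.
apply/(subspace_congr sS (y := psi j)) => //; apply: IS; split=> //.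
by apply: (subspaceB (ideal_subspace J)) => //; apply: SJ.
Qed.

Lemma ideal_not_radical : ~ radical_class (ideal_alg J).
Proof.
have [s Js nIs] := nJI.
have maxJ := preimage_maximal_right_ideal maximal_right_ideal_in_setI.
suff [x [y nI]] : exists x y : ideal_alg J, ~ I (\val x *n \val y).
  by apply: (maximal_right_ideal_not_radical maxJ (x0 := x) (a0 := y)) => -[].
have [psi [_ _ [j Jj nIj] psi_in]] := ideal_parametrization nIs.
(* If [J J] were inside [I], the last property of [psi] with [S = I :&: J] would put [psi j] into
   [I]. *)
apply: contrapT => none; apply: nIj.
apply: (psi_in (I `&` J) right_ideal_in_setI _ j Jj).1 => k Jk.
split; last exact: Defs.idealMr.
have [[x <-] [y <-]] := (ideal_alg_lift Js, ideal_alg_lift Jk).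
by apply: contrapT => nI; apply: none; exists x, y.
Qed.

End Restriction.

Section Core.
Variables (F : fieldType) (A : naAlgType F).

(** The core is the union of all ideals inside [I]; it is closed under addition because the sum of
    two such ideals is another one. *)
Lemma right_ideal_core (I : set A) : is_right_ideal I ->
  exists Q : ideal A, ideal_set Q `<=` I /\
    forall J, is_ideal J -> J `<=` I -> J `<=` Q.
Proof.
move=> rI; pose Q := [set x | exists J, [/\ is_ideal J, J `<=` I & J x]].
suff iQ : is_ideal Q.
  exists (Ideal iQ); split=> [x [J [_ JI /JI]]|J iJ JI x Jx] //.
  by exists J.
have sQ : is_subspace Q.
  split.
    exists [set 0]; split=> // [|x ->]; last exact: subspace0 rI.1.
    have s0 : @is_subspace F A [set 0].
      by split=> // c x y -> ->; rewrite /= scaler0 addr0.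
    split; split=> // x y /= ->.
      by rewrite namul0r.
    by rewrite namul0l.
  move=> c x y [J [iJ JI Jx]] [K [iK KI Ky]].
  have [[sJ lJ] [_ rJ]] := iJ; have [[sK lK] [_ rK]] := iK.
  exists [set z | exists u v, [/\ J u, K v & z = u + v]]; split; last first.
  - by exists (c *: x), y; split=> //; apply: (subspaceZ sJ).
  - by move=> _ [u [v [Ju Kv ->]]]; apply: (subspaceD rI.1); [apply: JI | apply: KI].
  - have sJK : is_subspace [set z | exists u v, [/\ J u, K v & z = u + v]].
      split.
        by exists 0, 0; split; [apply: subspace0 sJ | apply: subspace0 sK | rewrite addr0].
      move=> d _ _ [u [v [Ju Kv ->]]] [u' [v' [Ju' Kv' ->]]].
      exists (d *: u + u'), (d *: v + v'); split; [exact: sJ.2|exact: sK.2|].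
      by rewrite scalerDr addrACA.
    split; split=> // _ a [u [v [Ju Kv ->]]].
      by exists (a *n u), (a *n v); split; [apply: lJ | apply: lK | rewrite namulDr].
    by exists (u *n a), (v *n a); split; [apply: rJ | apply: rK | rewrite namulDl].
split; split=> // x a [J [iJ JI Jx]]; exists J; split=> //.
  exact: iJ.1.2.
exact: iJ.2.2.
Qed.

End Core.

Section QuotientTransfer.
Variables (F : fieldType) (A : novikovType F) (Q : ideal A).
Notation q := (@qclass F A Q).
Implicit Types (K : set (quot_alg Q)) (I : set A).

Lemma preimage_right_ideal K : is_right_ideal (q @^-1` K) <-> is_right_ideal K.
Proof.
split=> [[[I0 IS] IM]|[[K0 KS] KM]]; split; first split=> //.
- move=> c; elim/qclass_ind=> x; elim/qclass_ind=> y Kx Ky.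
  by rewrite -linearP; apply: IS.
- by elim/qclass_ind=> x; elim/qclass_ind=> y Kx; rewrite -qclassM; apply: IM.
- by split=> // c x y; rewrite /= linearP; apply: KS.
- by move=> x y; rewrite /= qclassM; apply: KM.
Qed.

Lemma preimage_ideal K : is_ideal (q @^-1` K) <-> is_ideal K.
Proof.
split=> [[[_ IM] /preimage_right_ideal rK]|[[_ KM] rK]]; split=> //.
- split; first exact: rK.1.
  by elim/qclass_ind=> x; elim/qclass_ind=> y Kx; rewrite -qclassM; apply: IM.
- split; first by case/preimage_right_ideal: rK.
  by move=> x y; rewrite /= qclassM; apply: KM.
- exact/preimage_right_ideal.
Qed.

(** The set of classes whose representative is in [I] serves as the image of [I] in [A / Q]; as [Q]
    lies in [I], the choice of representatives does not matter. *)
Lemma preimage_repr I : is_subspace I -> ideal_set Q `<=` I ->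
  q @^-1` [set y | I (repr y)] = I.
Proof.
move=> sI QI; apply/seteqP; split=> x /=;
  by have [] := subspace_congr sI (QI _ (repr_qclass Q x)).
Qed.

Lemma preimage_onto K K' : q @^-1` K `<=` q @^-1` K' -> K `<=` K'.
Proof. by move=> KK'; elim/qclass_ind=> x; apply: KK'. Qed.

Lemma sub_preimage K : is_right_ideal K -> ideal_set Q `<=` q @^-1` K.
Proof.
move=> rK x Qx; rewrite /= (_ : q x = 0); first exact: subspace0 rK.1.
by rewrite -(linear0 q); apply/qclassP; rewrite subr0.
Qed.

Lemma preimage_maximal K :
  is_maximal_right_ideal (q @^-1` K) <-> is_maximal_right_ideal K.
Proof.
split=> maxI.
- have [rI properI _] := maxI; have rK := (preimage_right_ideal K).1 rI.
  apply: maximal_right_ideal_of => //.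
    apply: contrapT => noK; apply: properI; apply/seteqP; split=> // x _.
    by apply: contrapT => nKx; apply: noK; exists (q x).
  move=> L y rL KL Ly nKy; elim/qclass_ind.
  apply: (maximal_right_ideal_top maxI ((preimage_right_ideal L).2 rL) (x := repr y)).
  + by move=> x; apply: KL.
  + by rewrite /= qclassK.
  + by rewrite /= qclassK.
- have [rK properK _] := maxI; have rI := (preimage_right_ideal K).2 rK.
  apply: maximal_right_ideal_of => //.
    apply: contrapT => noI; apply: properK; apply/seteqP; split=> // y _.
    by apply: contrapT => nKy; apply: noI; exists (repr y); rewrite /= qclassK.
  move=> L x rL IL Lx nIx.
  have QL : ideal_set Q `<=` L by move=> z Qz; apply/IL/(sub_preimage rK).
  have LE := preimage_repr rL.1 QL; rewrite -LE in rL IL Lx *; move=> y.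
  apply: (maximal_right_ideal_top maxI _ _ Lx nIx).
  + exact/preimage_right_ideal.
  + exact: preimage_onto.
Qed.

Lemma preimage_modular K : is_maximal_right_ideal K ->
  is_modular (q @^-1` K) <-> is_modular K.
Proof.
move=> maxK; have [rK properK _] := maxK.
have [rI properI _] := (preimage_maximal K).2 maxK.
split=> [/(is_modularP rI properI)|/(is_modularP rK properK)] modI.
- apply/(is_modularP rK properK).
  case: modI => [[e [f ef]]|[comm [u uP]]]; [left|right; split].
  + exists (q e), (q f); elim/qclass_ind=> a.
    by rewrite -qclass_associator -linearB; apply: ef.
  + elim/qclass_ind=> x; elim/qclass_ind=> y.
    by rewrite -!qclassM -linearB; apply: comm.
  + by exists (q u); elim/qclass_ind=> x; rewrite -qclassM -linearB; apply: uP.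
- apply/(is_modularP rI properI).
  case: modI => [[e [f ef]]|[comm [u uP]]]; [left|right; split].
  + exists (repr e), (repr f) => a.
    by rewrite /= linearB /= qclass_associator !qclassK; apply: ef.
  + by move=> x y; rewrite /= linearB /= !qclassM; apply: comm.
  + by exists (repr u) => x; rewrite /= linearB /= qclassM qclassK; apply: uP.
Qed.

Lemma primitive_idealP : primitive_ideal Q <->
  exists I, [/\ is_maximal_right_ideal I, is_modular I, ideal_set Q `<=` I &
    forall J, is_ideal J -> J `<=` I -> J `<=` Q].
Proof.
split=> [[K [maxK modK coreK]]|[I [maxI modI QI coreI]]].
- have [rK _ _] := maxK; exists (q @^-1` K); split.
  + exact/preimage_maximal.
  + exact/preimage_modular.
  + exact: sub_preimage.
  (* [J] need not contain [Q], so it is enlarged to the core [L] of the preimage of [K]; the image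
     of [L] is an ideal inside [K], hence zero. *)
  + move=> J iJ JK x Jx.
    have [L [LK coreL]] := right_ideal_core ((preimage_right_ideal K).2 rK).
    have QL : ideal_set Q `<=` L.
      by apply: coreL (idealP Q) _; apply: sub_preimage.
    have L0 : [set y : quot_alg Q | ideal_set L (repr y)] = [set 0].
      apply: coreK.
        by apply/preimage_ideal; rewrite preimage_repr //; [apply: idealP | apply: ideal_subspace].
      by apply: preimage_onto; rewrite preimage_repr //; apply: ideal_subspace.
    have : (q @^-1` [set y : quot_alg Q | ideal_set L (repr y)]) x.
      by rewrite preimage_repr //; [apply: coreL iJ JK x Jx | apply: ideal_subspace].
    rewrite L0 /= -(linear0 q) => /qclassP; by rewrite subr0.
- have [rI _ _] := maxI; have prI := preimage_repr rI.1 QI.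
  exists [set y | I (repr y)].
  have maxK : is_maximal_right_ideal [set y : quot_alg Q | I (repr y)].
    by apply/preimage_maximal; rewrite prI.
  split=> //; first by apply/(preimage_modular maxK); rewrite prI.
  move=> J iJ JI; apply/seteqP; split=> [|_ ->]; last exact: subspace0 iJ.2.1.
  elim/qclass_ind=> x Jx /=; rewrite -(linear0 q); apply/qclassP; rewrite subr0.
  apply: (coreI _ ((preimage_ideal J).2 iJ)) => // z Jz.
  by rewrite -prI; apply: JI.
Qed.

End QuotientTransfer.

(** * The radical as an intersection of primitive ideals, and subdirect products *)

Section JacobsonRadical.
Variables (F : fieldType) (A : novikovType F).

Fact primitive_intersection_ideal : is_ideal (primitive_intersection A).
Proof.
have sP : is_subspace (primitive_intersection A).
  split=> [I _|c x y Px Py I pI]; first exact: ideal0.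
  by apply: idealS; [apply: Px | apply: Py].
split; split=> // x a Px I pI.
  by apply/idealMl/Px.
by apply/Defs.idealMr/Px.
Qed.

Lemma radical_ideal_sub_primitive (J Q : ideal A) :
  radical_class (ideal_alg J) -> primitive_ideal Q -> ideal_set J `<=` Q.
Proof.
move=> radJ /primitive_idealP[I [maxI modI _ coreI]]; apply: coreI; first exact: idealP.
move=> x Jx; apply: contrapT => nIx.
by apply: ideal_not_radical maxI modI _ radJ; exists x.
Qed.

Lemma maximal_modular_extension (P : ideal A) (I : set (ideal_alg P)) :
  is_maximal_right_ideal I -> is_modular I ->
  exists I' : set A, [/\ is_maximal_right_ideal I', is_modular I' &
    exists2 p, ideal_set P p & ~ I' p].
Proof.
move=> maxI; have [rI properI _] := maxI.
have maxI' := image_maximal_right_ideal_in maxI.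
case/(is_modularP rI properI) => [[e [f ef]]|[comm [u uP]]].
- apply: (modular_extension_associator maxI' (ideal_alg_in e) (ideal_alg_in f)).
  by move=> _ /ideal_alg_lift[y <-]; apply/(image_val_in I (y - associator y e f)).
- apply: (modular_extension_unit maxI' _ (ideal_alg_in u)).
    move=> _ _ /ideal_alg_lift[x <-] /ideal_alg_lift[y <-].
    exact/(image_val_in I (x *n y - y *n x)).
  by move=> _ /ideal_alg_lift[x <-]; apply/(image_val_in I (u *n x - x)).
Qed.

Lemma primitive_intersection_jacobson :
  is_jacobson_radical A (primitive_intersection A).
Proof.
exists (Ideal primitive_intersection_ideal); split=> //; last first.
  by move=> J radJ x Jx Q primQ; apply: radical_ideal_sub_primitive radJ primQ x Jx.
move=> M rho rhoR irrM.
have [I [maxI modI]] := irreducible_module_modular rhoR irrM.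
have [I' [maxI' modI' [p Pp nIp]]] := maximal_modular_extension maxI modI.
have [rI' _ _] := maxI'.
have [Q [QI coreQ]] := right_ideal_core rI'.
(* The core [Q] of [I'] is primitive, so [p], lying in every primitive ideal, lies in [I']. *)
by apply/nIp/QI/Pp; apply/primitive_idealP; exists I'.
Qed.

End JacobsonRadical.

Lemma jacobson_radical_unique (F : fieldType) (A : novikovType F) (J K : set A) :
  is_jacobson_radical A J -> is_jacobson_radical A K -> J = K.
Proof.
move=> [I [-> radI maxI]] [I' [-> radI' maxI']].
by apply/seteqP; split; [apply: maxI' | apply: maxI].
Qed.

Theorem corollary5p6 (F : fieldType) (charF : 2%N \notin [pchar F]) :
  (forall A : novikovType F,
     is_jacobson_radical A (primitive_intersection A)) /\
  (forall A : novikovType F, J_semisimple A ->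
     exists (K : Type) (B : K -> novikovType F),
       (forall k : K, primitive_algebra (B k)) /\ is_subdirect_product A B).
Proof.
split=> [A|A ssA]; first exact: primitive_intersection_jacobson.
have P0 := jacobson_radical_unique (primitive_intersection_jacobson A) ssA.
(* The factors are all primitive quotients; if there are none, the intersection is [A], which is
   then 0, and the empty product suffices. *)
exists {I : ideal A | primitive_ideal I}, (fun k => quot_alg (sval k)).
split; first by case.
exists (fun x k => qclass (sval k) x); split.
- move=> x y xy; apply/eqP; rewrite -subr_eq0; apply/eqP.
  suff : primitive_intersection A (x - y) by rewrite P0.
  move=> I primI; apply/qclassP.
  exact: (congr1 (fun f => f (exist _ I primI)) xy).
- move=> k; split; first exact: qclass_linear.
  exact: qclassM.
- by move=> k b; exists (repr b); apply: qclassK.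
Qed.
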